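(* Let $\omega=(\omega_x)_{x\in\mathbb{Z}}$ be a random environment, i.e. a sequence of i.i.d. random variables with values in $(0,1)$ under a probability measure $\mathsf{P}$, such that, with $\rho_0:=\frac{1-\omega_0}{\omega_0}$: (i) $\mathsf{E}[\log\rho_0]=0$; (ii) $\mathsf{P}(\varepsilon\le\omega_0\le 1-\varepsilon)=1$ for some $\varepsilon\in(0,\tfrac12)$; (iii) $\mathsf{Var}(\log\rho_0)>0$. Let $0<\delta<1$. For fixed $\omega$, let $(X_n,Y_n)_{n\in\mathbb{N}_0}$ be the Markov chain with values in $\mathbb{Z}^2$ determined by $P_\omega\big((X_0,Y_0)=(0,0)\big)=1$ and, for all $(x,y)\in\mathbb{Z}^2$, $$P_\omega\big((X_{n+1},Y_{n+1})=(x+1,y)\mid(X_n,Y_n)=(x,y)\big)=\delta\,\omega_x,$$ $$P_\omega\big((X_{n+1},Y_{n+1})=(x-1,y)\mid(X_n,Y_n)=(x,y)\big)=\delta\,(1-\omega_x),$$ $$P_\omega\big((X_{n+1},Y_{n+1})=(x,y\pm1)\mid(X_n,Y_n)=(x,y)\big)=\frac{1-\delta}{2}.$$ Then $(X_n,Y_n)_{n\in\mathbb{N}_0}$ is recurrent for $\mathsf{P}$-a.e. environment $\omega$.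
   Context: $\mathbb{N}_0=\{0,1,2,\dots\}$. In the last transition probability, each of the two moves $(x,y+1)$ and $(x,y-1)$ has probability $\frac{1-\delta}{2}$. Recurrent means that, $P_\omega$-almost surely, the chain returns to its starting point $(0,0)$ infinitely often. *)

(* Defs.v *)
From HB Require Import structures.
From mathcomp Require Import all_boot all_order all_algebra.
From mathcomp Require Import all_classical all_reals all_analysis.

Set Implicit Arguments.
Unset Strict Implicit.
Unset Printing Implicit Defensive.

Import Order.TTheory GRing.Theory Num.Theory.
Import numFieldNormedType.Exports.

Local Open Scope classical_set_scope.
Local Open Scope ring_scope.

Definition mutually_independent (R : realType) (d : measure_display)
    (T : measurableType d) (P : probability T R) (I : choiceType)
    (X : I -> {RV P >-> R}) : Prop :=
  forall (s : seq I) (A : I -> set R),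
    uniq s -> (forall i, measurable (A i)) ->
    P (\bigcap_(i in [set` s]) (X i @^-1` A i)) =
    (\prod_(i <- s) P (X i @^-1` A i))%E.

Definition identically_distributed (R : realType) (d : measure_display)
    (T : measurableType d) (P : probability T R) (I : choiceType)
    (X : I -> {RV P >-> R}) : Prop :=
  forall (i j : I) (A : set R), measurable A ->
    distribution P (X i) A = distribution P (X j) A.

(* Used only when P B != 0. *)
Definition cond_prob (R : realType) (d : measure_display)
    (T : measurableType d) (P : probability T R) (A B : set T) : R :=
  fine (P (A `&` B)) / fine (P B).

(* Since S is countable, measurability of the fibres is measurability of Z n
   for the discrete sigma-algebra on S. *)
Definition markov_chain (R : realType) (d : measure_display)
    (T : measurableType d) (P : probability T R) (S : countType)
    (z0 : S) (p : S -> S -> R) (Z : nat -> T -> S) : Prop :=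
  [/\ forall n z, measurable [set t | Z n t = z],
      P [set t | Z 0%N t = z0] = 1%E
    & forall (n : nat) (z : nat -> S) (z' : S),
        let past := [set t | forall i, (i <= n)%N -> Z i t = z i] in
        P past != 0%E ->
        cond_prob P [set t | Z n.+1 t = z'] past = p (z n) z'].

Definition rho (R : realType) (w : R) : R := (1 - w) / w.

(* Steps to sites other than the four neighbours have probability 0. *)
Definition rwre_step (R : realType) (delta : R) (omega : int -> R)
    (z z' : int * int) : R :=
  if z' == (z.1 + 1, z.2) then delta * omega z.1
  else if z' == (z.1 - 1, z.2) then delta * (1 - omega z.1)
  else if (z' == (z.1, z.2 + 1)) || (z' == (z.1, z.2 - 1))
  then (1 - delta) / 2
  else 0.

(* Recurrence depends only on the law of the chain, so it is required of every
   realization of the chain on a probability space. *)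
Definition rwre_recurrent (R : realType) (delta : R) (omega : int -> R) : Prop :=
  forall (d : measure_display) (T : measurableType d) (P : probability T R)
         (Z : nat -> T -> int * int),
    markov_chain (S := (int * int)%type) P (0, 0) (rwre_step delta omega) Z ->
    {ae P, forall t, forall N : nat,
      exists n : nat, (N <= n)%N /\ Z n t = (0, 0)}.

(* Main.v *)
(** For a fixed environment the walk on Z^2 is a reversible network: with the
    potential V(x) - V(x - 1) = ln (rho (omega x)), V(0) = 0, the edge between
    (x, y) and (x + 1, y) has conductance proportional to c x = exp (- V x), and
    the vertical edges above x have conductance proportional to c x + c (x - 1).

    Let v z be the probability of never visiting the origin from z; it is
    harmonic off the origin, where its Laplacian is the escape probability.
    Testing this equation against f^2 (1 + v), f finitely supported with value 1
    at the origin, bounds the escape probability by a multiple of the energy of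
    f.  Taking f (x, y) = 1_[-a, b](x) (1 - |y| / L)^+ gives the bound
    L (c (-a-1) + c b) + (sum of c over [-a-1, b]) / L, which is small as soon
    as V climbs to height 3n on both sides of 0, within O(n^2) sites, before
    going below -n.

    V is a two-sided centred random walk with bounded steps.  Optional stopping
    for V and V^2 shows that each side climbs in this way with probability at
    least 1/10, uniformly in n, and this remains so when V is only observed
    beyond an already explored window that is small compared with n.  Using
    independence of successive windows, almost surely the climb succeeds on both
    sides at some scale, for every prescribed bound on the energy.  Finally, the
    chain returns to the origin infinitely often: otherwise it makes a last
    visit, and by the Markov property this has probability zero when the escape
    probability vanishes. *)
Require Import Defs.
From HB Require Import structures.
From mathcomp Require Import all_boot all_order all_algebra.
From mathcomp Require Import all_classical all_reals all_analysis.
From mathcomp Require Import measurable_realfun.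
From mathcomp Require Import ring lra zify.
Import Order.TTheory GRing.Theory Num.Theory.
Import numFieldNormedType.Exports.
Local Open Scope classical_set_scope.
Local Open Scope ring_scope.

Set Implicit Arguments.
Unset Strict Implicit.
Unset Printing Implicit Defensive.

(** * The escape probability and the energy of test functions *)

Lemma summation_by_parts (R : comRingType) (k v psi : nat -> R) (n : nat) :
  \sum_(i < n) psi i.+1 *
    (k i.+1 * (v i.+2 - v i.+1) - k i * (v i.+1 - v i)) =
  psi n * k n * (v n.+1 - v n) - psi 0%N * k 0%N * (v 1%N - v 0%N) -
  \sum_(i < n) k i * (v i.+1 - v i) * (psi i.+1 - psi i).
Proof.
elim: n => [|n IH]; first by rewrite !big_ord0; ring.
by rewrite !big_ord_recr /= IH; ring.
Qed.

(** With [w = 1 + v] and [w' = 1 + v'] the left side is [(f' - f)^2 w w' - (f' w' - f w)^2], and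
    [w w' <= 4] because both lie in [1, 2]. *)
Lemma edge_caccioppoli (R : realDomainType) (f f' v v' : R) :
  0 <= v <= 1 -> 0 <= v' <= 1 ->
  - ((v' - v) * (f' ^+ 2 * (1 + v') - f ^+ 2 * (1 + v))) <= 4 * (f' - f) ^+ 2.
Proof.
move=> /andP[v0 v1] /andP[v'0 v'1].
have vv' : v * v' <= 1 by rewrite mulr_ile1.
have sq := sqr_ge0 (f' * v' - f * v + (f' - f)).
have g2 := sqr_ge0 (f' - f).
have h1 : (f' - f) ^+ 2 * (v + v') <= (f' - f) ^+ 2 * 2 by rewrite ler_wpM2l//; lra.
have h2 : (f' - f) ^+ 2 * (v * v') <= (f' - f) ^+ 2 * 1 by rewrite ler_wpM2l//; lra.
suff -> : - ((v' - v) * (f' ^+ 2 * (1 + v') - f ^+ 2 * (1 + v))) =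
  - (f' * v' - f * v + (f' - f)) ^+ 2 + (f' - f) ^+ 2 +
   (f' - f) ^+ 2 * (v + v') + (f' - f) ^+ 2 * (v * v') by lra.
ring.
Qed.

(** The weight [f^2 (1 + v)] vanishes at 0 and [n], so summation by parts leaves no boundary term
    and the edges can be bounded one by one. This one-dimensional form serves for the rows and for
    the columns of a box. *)
Lemma caccioppoli (R : realDomainType) (k v f : nat -> R) (n : nat) :
  (forall i, 0 <= k i) -> (forall i, 0 <= v i <= 1) ->
  f 0%N = 0 -> f n = 0 ->
  \sum_(i < n) f i.+1 ^+ 2 * (1 + v i.+1) *
    (k i.+1 * (v i.+2 - v i.+1) - k i * (v i.+1 - v i)) <=
  4 * \sum_(i < n) k i * (f i.+1 - f i) ^+ 2.
Proof.
move=> k0 v01 f0 fn.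
rewrite (summation_by_parts k v (fun i => f i ^+ 2 * (1 + v i))) f0 fn.
rewrite expr0n /= !mul0r subrr sub0r -sumrN mulr_sumr ler_sum// => i _.
have := edge_caccioppoli (f i) (f i.+1) (v01 i) (v01 i.+1).
move/(ler_wpM2l (k0 i)); lra.
Qed.

Section escape.
Variables (R : realType) (delta : R) (omega : int -> R).
Hypothesis omega01 : forall x, 0 < omega x < 1.
Hypothesis delta01 : 0 < delta < 1.

Definition step_mean (f : int * int -> R) (z : int * int) : R :=
  delta * omega z.1 * f (z.1 + 1, z.2) +
  delta * (1 - omega z.1) * f (z.1 - 1, z.2) +
  (1 - delta) / 2 * f (z.1, z.2 + 1) + (1 - delta) / 2 * f (z.1, z.2 - 1).

(* The probability that the chain started at z does not visit the origin at
   the times 0, ..., n. *)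
Fixpoint avoid (n : nat) (z : int * int) : R :=
  if z == (0, 0) then 0
  else if n is m.+1 then step_mean (avoid m) z else 1.

Definition avoid_lim (z : int * int) : R := limn (avoid ^~ z).

Lemma le_step_mean f g z : (forall z, f z <= g z) ->
  step_mean f z <= step_mean g z.
Proof.
move=> fg; have /andP[w0 w1] := omega01 z.1; have /andP[d0 d1] := delta01.
by rewrite /step_mean !lerD// ler_wpM2l//; (apply: mulr_ge0 || idtac); lra.
Qed.

Lemma step_mean_cst a z : step_mean (fun=> a) z = a.
Proof. by rewrite /step_mean; lra. Qed.

Lemma avoid0 n : avoid n (0, 0) = 0.
Proof. by case: n. Qed.

Lemma avoid_ge0 n z : 0 <= avoid n z.
Proof.
elim: n z => [|n IH] z /=; case: ifP => // _.
by rewrite -(step_mean_cst 0 z) le_step_mean.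
Qed.

Lemma avoid_decr n z : avoid n.+1 z <= avoid n z.
Proof.
elim: n z => [|n IH] z; rewrite [avoid _.+1 z]/=; last first.
  by rewrite [leRHS]/=; case: ifP => // _; apply: le_step_mean.
rewrite [leRHS]/=; case: ifP => // _; rewrite -[leRHS](step_mean_cst 1 z).
by apply: le_step_mean => z' /=; case: ifP.
Qed.

Lemma avoid_le1 n z : avoid n z <= 1.
Proof.
elim: n => [|n IH]; last exact: le_trans (avoid_decr n z) IH.
by rewrite /=; case: ifP.
Qed.

Lemma avoid_cvg z : avoid ^~ z @ \oo --> avoid_lim z.
Proof.
apply: nonincreasing_is_cvgn.
  by apply/nonincreasing_seqP => n; exact: avoid_decr.
by exists 0 => _ [n _ <-]; exact: avoid_ge0.
Qed.

Lemma avoid_lim0 : avoid_lim (0, 0) = 0.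
Proof.
apply: cvg_lim => //; under eq_fun do rewrite avoid0.
exact: cvg_cst.
Qed.

Lemma avoid_lim01 z : 0 <= avoid_lim z <= 1.
Proof.
apply/andP; split.
  apply: limr_ge; first by apply/cvg_ex; exists (avoid_lim z); exact: avoid_cvg.
  by apply: nearW => n; exact: avoid_ge0.
apply: limr_le; first by apply/cvg_ex; exists (avoid_lim z); exact: avoid_cvg.
by apply: nearW => n; exact: avoid_le1.
Qed.

Lemma step_mean_cvg z :
  (fun n => step_mean (avoid n) z) @ \oo --> step_mean avoid_lim z.
Proof.
by rewrite /step_mean; do ![apply: cvgD];
  apply: cvgM; try exact: cvg_cst; exact: avoid_cvg.
Qed.

Lemma step_mean_avoid_lim (z : int * int) : z != (0, 0) -> step_mean avoid_lim z = avoid_lim z.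
Proof.
move=> z0; rewrite -(cvg_lim _ (@step_mean_cvg z))//; apply: cvg_lim => //.
have := @avoid_cvg z; rewrite -(cvg_shiftS (avoid ^~ z)) /=.
by rewrite (negbTE z0).
Qed.

(** As [avoid_lim] is 0 at the origin, the average is taken after one step: this is the probability
    of never returning after time 0. *)
Definition escape : R := step_mean avoid_lim (0, 0).

Lemma escape_ge0 : 0 <= escape.
Proof.
rewrite /escape -(step_mean_cst 0 (0, 0)); apply: le_step_mean => z.
by case/andP: (avoid_lim01 z).
Qed.

(** * Reversibility and the energy bound *)

Variable c : int -> R.
Hypothesis c_gt0 : forall x, 0 < c x.
Hypothesis c_balance : forall x, c x * (1 - omega x) = c (x - 1) * omega x.

(** The reversible measure of the sites in column [x], where [c x] belongs to the edges between
    columns [x] and [x + 1]. *)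
Let mass x := c x + c (x - 1).

(** Detailed balance puts the generator in divergence form, so that each direction can be summed by
    parts separately. *)
Lemma mass_generator z : mass z.1 * (step_mean avoid_lim z - avoid_lim z) =
  delta * (c z.1 * (avoid_lim (z.1 + 1, z.2) - avoid_lim z) -
           c (z.1 - 1) * (avoid_lim z - avoid_lim (z.1 - 1, z.2))) +
  (1 - delta) / 2 * (mass z.1 * (avoid_lim (z.1, z.2 + 1) - avoid_lim z) -
           mass z.1 * (avoid_lim z - avoid_lim (z.1, z.2 - 1))).
Proof.
have h1 : mass z.1 * omega z.1 = c z.1.
  by have := c_balance z.1; rewrite /mass; lra.
have h2 : mass z.1 * (1 - omega z.1) = c (z.1 - 1).
  by have := c_balance z.1; rewrite /mass; lra.
rewrite /step_mean -[in c z.1 * _]h1 -[in c (z.1 - 1) * _]h2 /mass.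
by field.
Qed.

Lemma mass0_escape_le (a b L : nat) : (0 < L)%N ->
  mass 0 * escape <= 8 * (L%:R * (c (- a.+1%:Z) + c b%:Z) +
    (\sum_(i < (a + b).+2) c (i%:Z - a.+1%:Z)) / L%:R).
Proof.
move=> L0; have /andP[d0 d1] := delta01.
have LR0 : 0 < L%:R :> R by rewrite ltr0n.
pose n := (a + b).+2; pose l := L.*2.
(* The box [-a-1, b+1] x [-L, L] is indexed from 0. [G] is the indicator of the columns -a, ..., b,
   [H] is the tent 1 - |y| / L, and their product [f] vanishes on the boundary of the box. *)
pose X (i : nat) : int := i%:Z - a.+1%:Z; pose Y (j : nat) : int := j%:Z - L%:Z.
have XD i : X i.+1 + 1 = X i.+2 by rewrite /X; lia.
have XB i : X i.+1 - 1 = X i by rewrite /X; lia.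
have YD i : Y i.+1 + 1 = Y i.+2 by rewrite /Y; lia.
have YB i : Y i.+1 - 1 = Y i by rewrite /Y; lia.
pose G (i : nat) : R := ((0 < i < n)%N)%:R.
pose H (j : nat) : R := (minn j (l - j))%:R / L%:R.
pose f i j := G i * H j.
pose v := avoid_lim.
pose D i j := f i.+1 j.+1 ^+ 2 * (1 + v (X i.+1, Y j.+1)) *
  (mass (X i.+1) * (step_mean v (X i.+1, Y j.+1) - v (X i.+1, Y j.+1))).
have ltan : (a < n)%N by rewrite /n; lia.
have ltLl : (L.-1 < l)%N by rewrite /l; lia.
have G01 i : 0 <= G i <= 1 by rewrite /G ler0n lern1 leq_b1.
have H01 j : 0 <= H j <= 1.
  rewrite /H divr_ge0// ?ler0n//= ler_pdivrMr// mul1r ler_nat /l; lia.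
have dH j : (j < l)%N -> (H j.+1 - H j) ^+ 2 = (L%:R ^+ 2)^-1.
  move=> jl; rewrite /H -mulrBl exprMn exprVn -[RHS]mul1r; congr (_ * _).
  case: (ltnP j L) => jL.
    have -> : (minn j (l - j) = j)%N by rewrite /l in jl *; lia.
    have -> : (minn j.+1 (l - j.+1) = j.+1)%N by rewrite /l in jl *; lia.
    by rewrite -natr1; ring.
  have -> : (minn j (l - j) = (minn j.+1 (l - j.+1)).+1)%N.
    by rewrite /l in jl *; lia.
  by rewrite -natr1; ring.
(* Harmonicity kills every site but the origin, found at [i = a], [j = L - 1]; there [f] is 1 and
   [avoid_lim] is 0. *)
have -> : mass 0 * escape = \sum_(j < l) \sum_(i < n) D i j.
  rewrite (bigD1 (Ordinal ltLl))//= (bigD1 (Ordinal ltan))//=.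
  have z0 : (X a.+1, Y L.-1.+1) = (0, 0).
    by rewrite /X /Y prednK//; congr pair; lia.
  rewrite !big1 ?addr0.
  - rewrite /D z0; move: z0; case=> -> _; rewrite /v avoid_lim0.
    rewrite /f /G /H prednK// (_ : minn L _ = L)//; last by rewrite /l; lia.
    rewrite (_ : (0 < a.+1 < n)%N = true)//; last by rewrite /n; lia.
    rewrite divff ?gt_eqF// /escape (_ : true%:R = 1 :> R)//.
    by rewrite !mulr1 expr1n addr0 !mul1r subr0.
  - move=> j jL; apply: big1 => i _; rewrite /D step_mean_avoid_lim ?subrr ?mulr0//.
    apply: contra jL => /eqP; rewrite /Y => -[_ h].
    by apply/eqP/val_inj => /=; lia.
  - move=> i ia; rewrite /D step_mean_avoid_lim ?subrr ?mulr0//.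
    apply: contra ia => /eqP; rewrite /X => -[h _].
    by apply/eqP/val_inj => /=; lia.
pose D1 i j := f i.+1 j.+1 ^+ 2 * (1 + v (X i.+1, Y j.+1)) *
  (c (X i.+1) * (v (X i.+2, Y j.+1) - v (X i.+1, Y j.+1)) -
   c (X i) * (v (X i.+1, Y j.+1) - v (X i, Y j.+1))).
pose D2 i j := f i.+1 j.+1 ^+ 2 * (1 + v (X i.+1, Y j.+1)) *
  (mass (X i.+1) * (v (X i.+1, Y j.+2) - v (X i.+1, Y j.+1)) -
   mass (X i.+1) * (v (X i.+1, Y j.+1) - v (X i.+1, Y j))).
have DE i j : D i j = delta * D1 i j + (1 - delta) / 2 * D2 i j.
  have := mass_generator (X i.+1, Y j.+1); rewrite /= XD XB YD YB => mg.
  by rewrite /D /v mg /D1 /D2 -/v; ring.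
have fl i : f i l = 0 by rewrite /f /H subnn minn0 mul0r mulr0.
have f0 i : f i 0%N = 0 by rewrite /f /H min0n mul0r mulr0.
have Gin i : (0 < i < n)%N -> G i = 1 by rewrite /G => ->.
have D1le (j : 'I_l) : \sum_(i < n) D1 i j <= 4 * (c (- a.+1%:Z) + c b%:Z).
  apply: (@le_trans _ _ (4 * \sum_(i < n) c (X i) * (f i.+1 j.+1 - f i j.+1) ^+ 2)).
    apply: (@caccioppoli _ (fun i => c (X i)) (fun i => v (X i, Y j.+1))
      (fun i => f i j.+1)).
    - by move=> i; exact: ltW.
    - by move=> i; exact: avoid_lim01.
    - by rewrite /f /G /= mul0r.
    - by rewrite /f /G ltnn andbF mul0r.
  (* Along a row [G] jumps only across the two extreme edges, whose conductances are [c (-a-1)] and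
     [c b]. *)
  rewrite ler_pM2l// big_ord_recl big_ord_recr /= big1 ?add0r; last first.
    move=> i _; have li := ltn_ord i; rewrite /f /bump /= !add1n.
    by rewrite Gin ?Gin ?subrr ?expr0n ?mulr0// /n; lia.
  rewrite /bump /= !add1n /f Gin; last by rewrite /n; lia.
  rewrite (_ : G 0%N = 0)// (_ : G n = 0); last by rewrite /G ltnn andbF.
  rewrite Gin; last by rewrite /n; lia.
  have -> : X 0 = - a.+1%:Z by rewrite /X; lia.
  have -> : X (a + b).+1 = b%:Z by rewrite /X; lia.
  have : H j.+1 ^+ 2 <= 1 by rewrite expr_le1//; case/andP: (H01 j.+1).
  have ca := c_gt0 (- a.+1%:Z); have cb := c_gt0 b%:Z.
  rewrite mul0r subr0 mul1r sub0r sqrrN => h.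
  by apply: lerD; rewrite -[leRHS]mulr1 ler_wpM2l// ltW.
have m0 x : 0 < mass x by rewrite addr_gt0.
(* In a column the tent has 2L edges of squared slope 1 / L^2, whence the factor 2 / L. *)
have D2le (i : 'I_n) : \sum_(j < l) D2 i j <= 4 * (mass (X i.+1) * G i.+1 * 2 / L%:R).
  apply: (@le_trans _ _ (4 * \sum_(j < l) mass (X i.+1) * (f i.+1 j.+1 - f i.+1 j) ^+ 2)).
    apply: (@caccioppoli _ (fun=> mass (X i.+1)) (fun j => v (X i.+1, Y j))
      (fun j => f i.+1 j)) => //.
    - by move=> _; exact: ltW.
    - by move=> j; exact: avoid_lim01.
  rewrite ler_pM2l//.
  under eq_bigr => j _.
    rewrite /f -mulrBr exprMn dH//.
    over.
  rewrite sumr_const card_ord /l -mul2n.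
  have -> : G i.+1 ^+ 2 = G i.+1.
    by rewrite /G; case: (_ && _); rewrite ?expr1n ?expr0n.
  rewrite -[leLHS]mulr_natr natrM.
  by rewrite le_eqVlt; apply/orP; left; apply/eqP; field; rewrite gt_eqF.
(* Each [c (X i)] enters the masses of at most two columns. *)
have sumG : \sum_(i < n) mass (X i.+1) * G i.+1 <= 2 * \sum_(i < n) c (X i).
  rewrite big_ord_recr /= {2}/G ltnn andbF mulr0 addr0.
  apply: (@le_trans _ _ (\sum_(i < (a + b).+1) (c (X i.+1) + c (X i)))).
    apply: ler_sum => i _; rewrite /mass XB -[leRHS]mulr1 ler_wpM2l//.
      by have := c_gt0 (X i.+1); have := c_gt0 (X i); lra.
    by case/andP: (G01 i.+1).
  rewrite big_split /= mulr_natl mulr2n; apply: lerD.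
    by rewrite [leRHS]big_ord_recl /= -[leLHS]add0r lerD// ltW.
  by rewrite [leRHS]big_ord_recr /= -[leLHS]addr0 lerD// ltW.
under eq_bigr do under eq_bigr do rewrite DE.
under eq_bigr do rewrite big_split -!mulr_sumr /=.
rewrite big_split -!mulr_sumr /= [in leLHS]addrC [in leLHS]exchange_big addrC /=.
have B1 : \sum_(j < l) \sum_(i < n) D1 i j <= 8 * (L%:R * (c (- a.+1%:Z) + c b%:Z)).
  apply: le_trans (ler_sum _ (fun j _ => D1le j)) _.
  rewrite sumr_const card_ord -[leLHS]mulr_natr /l -mul2n natrM.
  by rewrite le_eqVlt; apply/orP; left; apply/eqP; ring.
have B2 : \sum_(i < n) \sum_(j < l) D2 i j <= 16 * ((\sum_(i < n) c (X i)) / L%:R).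
  apply: le_trans (ler_sum _ (fun j _ => D2le j)) _.
  rewrite -mulr_sumr -!mulr_suml.
  have iL0 : 0 <= L%:R^-1 :> R by rewrite invr_ge0 ltW.
  by have := ler_wpM2r iL0 sumG; lra.
have S0 : 0 <= (\sum_(i < n) c (X i)) / L%:R.
  by rewrite divr_ge0//; apply: sumr_ge0 => i _; exact: ltW.
have C0 : 0 <= L%:R * (c (- a.+1%:Z) + c b%:Z).
  by rewrite mulr_ge0//; have := c_gt0 (- a.+1%:Z); have := c_gt0 b%:Z; lra.
(* The horizontal part carries a factor delta <= 1, the vertical part (1 - delta) / 2, which brings
   16 below 8. *)
rewrite mulrDr; apply: lerD.
  apply: le_trans (ler_wpM2l (ltW d0) B1) _.
  by have := ler_wpM2r C0 (ltW d1); lra.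
have d2 : 0 <= (1 - delta) / 2 by lra.
apply: le_trans (ler_wpM2l d2 B2) _.
have := mulr_ge0 (ltW d0) S0.
rewrite -[\sum_(i < (a + b).+2) _]/(\sum_(i < n) c (X i)).
by move: (_ / L%:R) => S; lra.
Qed.

Lemma escape_eq0 :
  (forall eps : R, 0 < eps -> exists a b L : nat, (0 < L)%N /\
    L%:R * (c (- a.+1%:Z) + c b%:Z) +
    (\sum_(i < (a + b).+2) c (i%:Z - a.+1%:Z)) / L%:R < eps) ->
  escape = 0.
Proof.
move=> small; apply/eqP; rewrite eq_le escape_ge0 andbT.
have m0 : 0 < mass 0 by rewrite addr_gt0.
apply/ler_addgt0Pr => e e0; rewrite add0r -(ler_pM2l m0).
have [|a [b [L [L0 lt]]]] := small (mass 0 * e / 8); first by rewrite divr_gt0// mulr_gt0.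
by apply: le_trans (mass0_escape_le a b L0) _; lra.
Qed.
End escape.

(** * Last visit to the origin *)

Section markov.
Variables (R : realType) (delta : R) (omega : int -> R).
Hypothesis omega01 : forall x, 0 < omega x < 1.
Hypothesis delta01 : 0 < delta < 1.
Variables (d : measure_display) (T : measurableType d) (P : probability T R).
Variable Z : nat -> T -> int * int.
Hypothesis chain :
  markov_chain (S := (int * int)%type) P (0, 0) (rwre_step delta omega) Z.

Let p (A : set T) : R := fine (P A).

Let pE A : measurable A -> P A = (p A)%:E.
Proof. by move=> mA; rewrite fineK// fin_num_measure. Qed.

Let p_ge0 A : 0 <= p A.
Proof. by rewrite fine_ge0. Qed.

Let le_p A B : measurable A -> measurable B -> A `<=` B -> p A <= p B.
Proof.
by move=> mA mB AB; rewrite -lee_fin -!pE//; apply: le_measure => //; rewrite inE.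
Qed.

Let pI A B : measurable A -> measurable B -> p A = p (A `&` B) + p (A `&` ~` B).
Proof.
move=> mA mB; have mAB := measurableI _ _ mA mB.
have mAC := measurableI _ _ mA (measurableC mB).
apply/EFin_inj; rewrite EFinD -!pE// -measureU//.
  by rewrite -setIUr setUv setIT.
by rewrite setIACA setICr setI0.
Qed.

Let mZ n z : measurable [set t | Z n t = z].
Proof. by case: chain. Qed.

Let mZin n (s : seq (int * int)) : measurable [set t | Z n t \in s].
Proof.
elim: s => [|z s IH].
  by rewrite (_ : [set _ | _] = set0)//; apply/seteqP; split=> t.

rewrite (_ : [set _ | _] = [set t | Z n t = z] `|` [set t | Z n t \in s]).
  exact: measurableU.
apply/seteqP; split => t /=; rewrite inE.
  by move=> /orP[/eqP|]; [left|right].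
by move=> [->|->]; rewrite ?eqxx ?orbT.
Qed.

Let p_split n (s : seq (int * int)) A : uniq s -> measurable A ->
  p A = \sum_(z <- s) p (A `&` [set t | Z n t = z]) +
        p (A `&` ~` [set t | Z n t \in s]).
Proof.
elim: s A => [|z s IH] A /=.
  move=> _ _; rewrite big_nil add0r; congr p.
  by apply/seteqP; split => t /=; [move=> At; split|case].
move=> /andP[zs us] mA; rewrite big_cons (pI mA (mZ n z)) -addrA; congr (_ + _).
rewrite (IH _ us); last by apply: measurableI => //; exact: measurableC.
congr (_ + _).
  apply: eq_big_seq => z' z's; congr p; apply/seteqP; split => t /=; first by case=> -[].
  by move=> [At zt]; split=> //; split=> // h; move: zs; rewrite -h zt z's.
congr p; apply/seteqP; split => t /=.
  move=> [[At h] h']; split=> //; rewrite inE => /orP[/eqP//|//].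
move=> [At h]; split; first split=> //.
  by move=> zt; apply: h; rewrite inE zt eqxx.
by move=> zt; apply: h; rewrite inE zt orbT.
Qed.

Let past n (z : nat -> int * int) : set T :=
  [set t | forall i, (i <= n)%N -> Z i t = z i].

Let mpast n z : measurable (past n z).
Proof.
rewrite (_ : past n z = \bigcap_(i in [set i | (i <= n)%N]) [set t | Z i t = z i]).
  by apply: bigcap_measurable => //; exists 0%N.
by [].
Qed.

Let nbrs (z : int * int) : seq (int * int) :=
  [:: (z.1 + 1, z.2); (z.1 - 1, z.2); (z.1, z.2 + 1); (z.1, z.2 - 1)].

Let uniq_nbrs z : uniq (nbrs z).
Proof. by case: z => x y; rewrite /nbrs /= !inE !xpair_eqE /=; lia. Qed.

Let step_meanE (f : int * int -> R) z :
  step_mean delta omega f z =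
  \sum_(z' <- nbrs z) rwre_step delta omega z z' * f z'.
Proof.
case: z => x y; rewrite /nbrs !big_cons big_nil /rwre_step /= !xpair_eqE /=.
have [-> -> ->] : [/\ (x == x + 1) = false, (x == x - 1) = false
    & (x - 1 == x + 1) = false] by split; lia.
rewrite !eqxx /= orbT.
by rewrite /step_mean /=; ring.
Qed.

Lemma transition n z z' : p (past n z `&` [set t | Z n.+1 t = z']) =
  p (past n z) * rwre_step delta omega (z n) z'.
Proof.
(* The Markov property is silent on null pasts; there both sides are 0. *)
have [P0|P0] := eqVneq (P (past n z)) 0%E.
  rewrite {2}/p P0 mul0r; apply/eqP; rewrite eq_le p_ge0 andbT.
  apply: (@le_trans _ _ (p (past n z))); last by rewrite /p P0.
  by apply: le_p => //; exact: measurableI.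
case: chain => _ _ /(_ n z z' P0) <-; rewrite /cond_prob -!/(p _) setIC.
rewrite mulrCA divff ?mulr1//; apply: contra P0 => /eqP p0.
by rewrite pE// p0.
Qed.

(** Conditioning on the next site: a bound given the past and that site is averaged by
    [step_mean]. *)
Lemma one_step n z (B : set T) (g : int * int -> R) : measurable B ->
  (forall z', p (past n z `&` [set t | Z n.+1 t = z'] `&` B) <=
     p (past n z `&` [set t | Z n.+1 t = z']) * g z') ->
  p (past n z `&` B) <= p (past n z) * step_mean delta omega g (z n).
Proof.
move=> mB Bg; have mA := mpast n z.
(* The probabilities of the four moves sum to 1, so moving anywhere else is a null event. *)
have rest : p (past n z `&` ~` [set t | Z n.+1 t \in nbrs (z n)]) = 0.
  have := p_split n.+1 (uniq_nbrs (z n)) mA.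
  under eq_bigr do rewrite transition.
  have := step_meanE (fun=> 1) (z n); rewrite step_mean_cst.
  by rewrite -mulr_suml mulr1 -mulr_sumr => <-; lra.
rewrite (p_split n.+1 (uniq_nbrs (z n)) (measurableI _ _ mA mB)).
rewrite (_ : p (_ `&` ~` _) = 0) ?addr0; last first.
  apply/eqP; rewrite eq_le p_ge0 andbT -rest; apply: le_p.
  - by apply: measurableI; [exact: measurableI|exact: measurableC].
  - by apply: measurableI => //; exact: measurableC.
  - by move=> t [[]].
rewrite step_meanE mulr_sumr; apply: ler_sum => z' _.
by rewrite setIAC mulrA -transition.
Qed.

Let past_extend n z z' : past n z `&` [set t | Z n.+1 t = z'] =
  past n.+1 (fun i => if (i <= n)%N then z i else z').
Proof.
apply/seteqP; split => t /=.
  move=> [h1 h2] i; rewrite leq_eqVlt => /orP[/eqP ->|]; first by rewrite ltnn.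
  by rewrite ltnS => ni; rewrite ni h1.
move=> h; split; last by rewrite h// ltnn.
by move=> i ni; rewrite h ?ni// (leq_trans ni).
Qed.

Let away m k : set T := [set t | forall i, (m <= i <= k)%N -> Z i t <> (0, 0)].

Let maway m k : measurable (away m k).
Proof.
rewrite (_ : away m k =
  \bigcap_(i in [set i | (m <= i <= k)%N]) ~` [set t | Z i t = (0, 0)]) //.
have [->|/set0P h] := eqVneq [set i | (m <= i <= k)%N] set0.
  by rewrite bigcap_set0.
by apply: bigcap_measurable => // i _; exact: measurableC.
Qed.

(** Induction on [n] through the next step. An inequality is enough, since it only has to produce
    null sets. *)
Lemma past_away n m z :
  p (past m z `&` away m (m + n)) <= p (past m z) * avoid delta omega n (z m).
Proof.
elim: n m z => [|n IH] m z.
  rewrite /=; case: ifPn => [/eqP zm|_].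
    rewrite mulr0 (_ : _ `&` _ = set0) ?/p ?measure0//.
    apply/seteqP; split => // t [h1 h2]; apply: (h2 m).
      by rewrite leqnn addn0 leqnn.
    by rewrite h1.
  by rewrite mulr1; apply: le_p => //; exact: measurableI.
rewrite /=; case: ifPn => [/eqP zm|_].
  rewrite mulr0 (_ : _ `&` _ = set0) ?/p ?measure0//.
  apply/seteqP; split => // t [h1 h2]; apply: (h2 m).
    by rewrite leqnn leq_addr.
  by rewrite h1.
apply: (@le_trans _ _ (p (past m z `&` away m.+1 (m.+1 + n)))).
  apply: le_p; try exact: measurableI.
  move=> t [h1 h2]; split=> // i /andP[h3 h4]; apply: h2.
  by rewrite (ltnW h3) addnS -addSn.
apply: one_step => // z'; rewrite past_extend.
by apply: le_trans (IH _ _) _; rewrite ltnn.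
Qed.

Lemma past_no_return n m z : p (past m z `&` away m.+1 (m.+1 + n)) <=
  p (past m z) * step_mean delta omega (avoid delta omega n) (z m).
Proof.
apply: one_step => // z'; rewrite past_extend.
by apply: le_trans (past_away _ _ _) _; rewrite ltnn.
Qed.

(** The bounds of [past_no_return] converge, as [n] grows, to the probability of the past times the
    escape probability. *)
Lemma past_never_return m z : escape delta omega = 0 -> z m = (0, 0) ->
  P.-negligible (past m z `&` [set t | forall i, (m < i)%N -> Z i t <> (0, 0)]).
Proof.
move=> esc0 zm; set A := _ `&` _.
have mA : measurable A.
  apply: measurableI => //.
  rewrite (_ : [set _ | _] =
    \bigcap_(i in [set i | (m < i)%N]) ~` [set t | Z i t = (0, 0)]) //.
  by apply: bigcap_measurable => [|i _]; [exists m.+1 => /=|exact: measurableC].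
apply/negligibleP => //; apply: etrans (pE mA) _; congr EFin.
apply/eqP; rewrite eq_le p_ge0 andbT.
have cv0 := @step_mean_cvg _ _ _ omega01 delta01 (0, 0).
have /(cvgM (cvg_cst (p (past m z)))) := cv0.
rewrite -/(escape delta omega) esc0 mulr0 => cv.
rewrite -(cvg_lim _ cv)//; apply: limr_ge; first by apply/cvg_ex; exists 0.
 apply: nearW => n /=; rewrite -zm.
apply: le_trans (past_no_return n m z); apply: le_p => //; first exact: measurableI.
by move=> t [h1 h2]; split=> // i /andP[h3 _]; exact: h2.
Qed.

Lemma escape0_returns : escape delta omega = 0 ->
  {ae P, forall t, forall N : nat, exists n : nat, (N <= n)%N /\ Z n t = (0, 0)}.
Proof.
move=> esc0.
pose z_ (s : seq (int * int)) i := nth (0, 0) s i.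
(* A code [(m, s)] prescribes the path up to time [m], where it makes its last visit to the origin.
   Codes are countable, so [bad'] lists all these null events. *)
pose bad (ms : nat * seq (int * int)) := past ms.1 (z_ ms.2) `&`
  [set t | z_ ms.2 ms.1 = (0, 0) /\ forall i, (ms.1 < i)%N -> Z i t <> (0, 0)].
pose bad' k := if unpickle k is Some ms then bad ms else set0.
have nbad k : P.-negligible (bad' k).
  rewrite /bad'; case: unpickle => [[m s]|]; last exact: negligible_set0.
  rewrite /bad /=; have [h|h] := eqVneq (z_ s m) (0, 0).
    apply: negligibleS (past_never_return esc0 h).
    by move=> t [h1 [_ h2]]; split.
  rewrite (_ : _ `&` _ = set0); first exact: negligible_set0.
  by apply/seteqP; split => // t [_ [h1]]; move: h; rewrite h1 eqxx.
have n0 : P.-negligible (~` [set t | Z 0%N t = (0, 0)]).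
  apply/negligibleP; first exact: measurableC.
  apply: etrans (probability_setC P (mZ _ _)) _.
  by case: chain => _ -> _; rewrite subee.
apply: negligibleS (negligibleU n0 (negligible_bigcup nbad)).
move=> t /= /existsNP[N hN].
have [Z0|] := eqVneq (Z 0%N t) (0, 0); last by move=> /eqP; left.
right; have zN n : Z n t == (0, 0) -> (n <= N)%N.
  move=> /eqP Zn; rewrite leqNgt; apply/negP => nN; apply: hN; exists n.
  by split => //; exact: ltnW.
have ex0 : exists n, Z n t == (0, 0) by exists 0%N; rewrite Z0.
(* The visit at time 0 ensures that a last visit [m] exists; the observed path up to [m] is the
   code. *)
case: (ex_maxnP ex0 zN) => m /eqP Zm mmax.
exists (pickle (m, [seq Z i t | i <- iota 0 m.+1])) => //.
rewrite /bad' pickleK /bad /=.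
have nthE i : (i <= m)%N -> z_ [seq Z i t | i <- iota 0 m.+1] i = Z i t.
  by move=> im; rewrite /z_ (nth_map 0%N) ?size_iota// nth_iota// add0n.
split; first by move=> i im; rewrite nthE.
split; first by rewrite nthE.
by move=> i mi /eqP /mmax; rewrite leqNgt mi.
Qed.
End markov.

(** * Independence *)

Section bounded_expectation.
Variables (R : realType) (d : measure_display) (T : measurableType d).
Variable P : probability T R.

(** The bound holds at every point, so sums and products stay in the class and integrability is
    automatic. *)
Definition bounded_rv (X : T -> R) :=
  measurable_fun setT X /\ exists M : R, forall t, `|X t| <= M.

Definition mean (X : T -> R) : R := \int[P]_t X t.

Lemma bounded_rv_integrable X : bounded_rv X -> P.-integrable setT (EFin \o X).
Proof.
move=> [mX [M XM]]; apply: measurable_bounded_integrable => //.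
  by rewrite (le_lt_trans (probability_le1 _ _))// ltry.
exists M; split; first exact: num_real.
by move=> y My t _; exact: le_trans (XM t) (ltW My).
Qed.

Lemma bounded_rv_cst a : bounded_rv (fun=> a).
Proof. by split; [exact: measurable_cst|exists `|a|]. Qed.

Lemma bounded_rvD X Y : bounded_rv X -> bounded_rv Y ->
  bounded_rv (fun t => X t + Y t).
Proof.
move=> [mX [M XM]] [mY [N YN]]; split; first exact: measurable_funD.
by exists (M + N) => t; apply: le_trans (ler_normD _ _) (lerD (XM t) (YN t)).
Qed.

Lemma bounded_rvM X Y : bounded_rv X -> bounded_rv Y ->
  bounded_rv (fun t => X t * Y t).
Proof.
move=> [mX [M XM]] [mY [N YN]]; split; first exact: measurable_funM.
by exists (M * N) => t; rewrite normrM ler_pM.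
Qed.

Lemma bounded_rvZ a X : bounded_rv X -> bounded_rv (fun t => a * X t).
Proof. exact: bounded_rvM (bounded_rv_cst a). Qed.

Lemma bounded_rvN X : bounded_rv X -> bounded_rv (fun t => - X t).
Proof.
move=> [mX [M XM]]; split; last by exists M => t; rewrite normrN.
exact: measurableT_comp mX.
Qed.

Lemma bounded_rvB X Y : bounded_rv X -> bounded_rv Y ->
  bounded_rv (fun t => X t - Y t).
Proof. by move=> bX /bounded_rvN; exact: bounded_rvD. Qed.

Lemma bounded_rv_sum (I : Type) (s : seq I) (F : I -> T -> R) :
  (forall i, bounded_rv (F i)) -> bounded_rv (fun t => \sum_(i <- s) F i t).
Proof.
move=> bF; elim: s => [|i s IH].
  by under eq_fun do rewrite big_nil; exact: bounded_rv_cst.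
by under eq_fun do rewrite big_cons; exact: bounded_rvD.
Qed.

Lemma bounded_rv_indic A : measurable A -> bounded_rv (\1_A).
Proof.
move=> mA; split; first exact: measurable_indic.
by exists 1 => t; rewrite indicE; case: (_ \in _); rewrite ?normr1 ?normr0.
Qed.

Lemma meanD X Y : bounded_rv X -> bounded_rv Y ->
  mean (fun t => X t + Y t) = mean X + mean Y.
Proof. by move=> bX bY; rewrite /mean RintegralD//; exact: bounded_rv_integrable. Qed.

Lemma meanB X Y : bounded_rv X -> bounded_rv Y ->
  mean (fun t => X t - Y t) = mean X - mean Y.
Proof. by move=> bX bY; rewrite /mean RintegralB//; exact: bounded_rv_integrable. Qed.

Lemma meanZ a X : bounded_rv X -> mean (fun t => a * X t) = a * mean X.
Proof. by move=> bX; rewrite /mean RintegralZl//; exact: bounded_rv_integrable. Qed.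

Lemma mean_cst a : mean (fun=> a) = a.
Proof.
rewrite /mean Rintegral_cst// -[RHS]mulr1; congr (_ * _).
by rewrite (_ : fine _ = fine 1%E)//; congr fine; exact: probability_setT.
Qed.

Lemma mean_sum (I : Type) (s : seq I) (F : I -> T -> R) :
  (forall i, bounded_rv (F i)) ->
  mean (fun t => \sum_(i <- s) F i t) = \sum_(i <- s) mean (F i).
Proof.
move=> bF; elim: s => [|i s IH].
  by under eq_fun do rewrite big_nil; rewrite big_nil mean_cst.
under eq_fun do rewrite big_cons; rewrite big_cons -IH meanD//.
exact: bounded_rv_sum.
Qed.

Lemma mean_indic A : measurable A -> mean (\1_A) = fine (P A).
Proof. by move=> mA; rewrite /mean /Rintegral integral_indic// setIT. Qed.

Lemma le_mean X Y : bounded_rv X -> bounded_rv Y -> (forall t, X t <= Y t) ->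
  mean X <= mean Y.
Proof. by move=> bX bY XY; apply: le_Rintegral => //; exact: bounded_rv_integrable. Qed.

Lemma norm_mean_le X (M : R) : bounded_rv X -> (forall t, `|X t| <= M) -> `|mean X| <= M.
Proof.
move=> bX XM; rewrite ler_norml; apply/andP; split.
  rewrite -(mean_cst (- M)); apply: le_mean => //; first exact: bounded_rv_cst.
  by move=> t; have := XM t; rewrite ler_norml => /andP[].
rewrite -(mean_cst M); apply: le_mean => //; first exact: bounded_rv_cst.
by move=> t; have := XM t; rewrite ler_norml => /andP[].
Qed.

(* W is approximated uniformly by a combination of indicators of events
   [W in C]. *)
Lemma mean_mul_eq0 W Y : bounded_rv W -> bounded_rv Y ->
  (forall C, measurable C -> mean (fun t => \1_(W @^-1` C) t * Y t) = 0) ->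
  mean (fun t => W t * Y t) = 0.
Proof.
move=> bW bY WC; have [mW [M WM]] := bW; have [mY [K YK]] := bY.
have mWC C : measurable C -> measurable (W @^-1` C).
  by move=> mC; rewrite -[X in measurable X]setTI; exact: mW.
apply/eqP; rewrite -normr_le0; apply/ler_addgt0Pr => e e0; rewrite add0r.
have K0 : 0 <= K by exact: le_trans (normr_ge0 _) (YK point).
(* A mesh [h] costs at most [h K <= e], and [K + 1] is positive even if [K] is 0. The [N] cells
   [J i] cover [-M, M]. *)
pose h : R := e / (K + 1).
have h0 : 0 < h by rewrite divr_gt0//; lra.
pose J (i : nat) : set R := `[i%:R * h - M, i.+1%:R * h - M[%classic.
pose N : nat := (Num.truncn (2 * M / h)).+1.
pose V t := \sum_(i <- iota 0 N) (i%:R * h - M) * \1_(W @^-1` (J i)) t.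
have mJ i : measurable (J i) by exact: measurable_itv.
have bI i : bounded_rv (\1_(W @^-1` (J i))) by apply/bounded_rv_indic/mWC.
have bV : bounded_rv V by apply: bounded_rv_sum => i; exact: bounded_rvZ.
have VW t : `|W t - V t| <= h.
  have /ler_normlP[WM1 WM2] := WM t.
  have WM0 : 0 <= (W t + M) / h by rewrite divr_ge0 ?(ltW h0)//; lra.
  pose k := Num.truncn ((W t + M) / h).
  have /andP[k1 k2] := Num.Theory.truncn_itv WM0; rewrite -/k in k1 k2.
  have k1' : k%:R * h <= W t + M by rewrite -ler_pdivlMr.
  have k2' : W t + M < k.+1%:R * h by rewrite -ltr_pdivrMr.
  have kN : (k < N)%N.
    rewrite ltnS; apply: Num.Theory.le_truncn.
    by rewrite ler_pM2r ?invr_gt0//; lra.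
  have Ji i : (\1_(W @^-1` (J i)) t : R) = (i == k)%:R.
    rewrite indicE; congr (nat_of_bool _)%:R; rewrite /J; apply/idP/eqP.
      rewrite inE /= in_itv /= => /andP[i1 i2].
      have : i%:R < k.+1%:R :> R by rewrite -(ltr_pM2r h0); lra.
      have : k%:R < i.+1%:R :> R by rewrite -(ltr_pM2r h0); lra.
      by rewrite !ltr_nat; lia.
    by move=> ->; rewrite inE /= in_itv /=; apply/andP; split; lra.
  have -> : V t = k%:R * h - M.
    have kin : k \in iota 0 N by rewrite mem_iota add0n.
    rewrite /V (bigD1_seq k kin (iota_uniq _ _)) /= Ji eqxx mulr1 big1 ?addr0// => i /negbTE ik.
    by rewrite Ji ik mulr0.
  rewrite -natr1 in k2'; rewrite ler_norml; apply/andP; split; lra.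
have -> : mean (fun t => W t * Y t) = mean (fun t => (W t - V t) * Y t).
  have -> : (fun t => (W t - V t) * Y t) = (fun t => W t * Y t - V t * Y t).
    by apply/funext => t; ring.
  rewrite meanB; [|exact: bounded_rvM|exact: bounded_rvM].
  rewrite [X in _ - X](_ : _ = 0) ?subr0//.
  have -> : (fun t => V t * Y t) = (fun t =>
      \sum_(i <- iota 0 N) (i%:R * h - M) * (\1_(W @^-1` (J i)) t * Y t)).
    by apply/funext => t; rewrite /V mulr_suml; apply: eq_bigr => i _; ring.
  rewrite mean_sum; last by move=> i; apply: bounded_rvZ; exact: bounded_rvM.
  apply: big1 => i _; rewrite meanZ; last exact: bounded_rvM.
  by rewrite WC ?mulr0.
apply: (@norm_mean_le _ e); first by apply: bounded_rvM => //; exact: bounded_rvB.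
move=> t; rewrite normrM; apply: (@le_trans _ _ (h * K)); first by rewrite ler_pM.
by rewrite /h mulrAC ler_pdivrMr ?ler_wpM2l//; lra.
Qed.

(** Centring [Y] reduces this to [mean_mul_eq0]. *)
Lemma mean_mul_of_events W Y : bounded_rv W -> bounded_rv Y ->
  (forall C, measurable C ->
     mean (fun t => \1_(W @^-1` C) t * Y t) = fine (P (W @^-1` C)) * mean Y) ->
  mean (fun t => W t * Y t) = mean W * mean Y.
Proof.
move=> bW bY WC.
have bWC C : measurable C -> bounded_rv (\1_(W @^-1` C)).
  move=> mC; apply: bounded_rv_indic; rewrite -[X in measurable X]setTI.
  by case: bW => mW _; exact: mW.
have bc := bounded_rv_cst (mean Y).
apply/eqP; rewrite -subr_eq0.
have : mean (fun t => W t * (Y t - mean Y)) = 0.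
  apply: mean_mul_eq0 => //; first exact: bounded_rvB.
  move=> C mC; have -> : (fun t => \1_(W @^-1` C) t * (Y t - mean Y)) =
    (fun t => \1_(W @^-1` C) t * Y t - mean Y * \1_(W @^-1` C) t).
    by apply/funext => t; ring.
  rewrite meanB; [|by apply: bounded_rvM => //; exact: bWC
                  |by apply: bounded_rvZ; exact: bWC].
  rewrite WC// meanZ; last exact: bWC.
  rewrite mean_indic; last first.
    rewrite -[X in measurable X]setTI; by case: bW => mW _; exact: mW.
  by rewrite mulrC subrr.
have -> : (fun t => W t * (Y t - mean Y)) = (fun t => W t * Y t - mean Y * W t).
  by apply/funext => t; ring.
rewrite meanB; [|exact: bounded_rvM|exact: bounded_rvZ].
by rewrite meanZ// mulrC => ->.
Qed.

(** The product rule passes from events to variables in one factor at a time. *)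
Lemma mean_mul W Y : bounded_rv W -> bounded_rv Y ->
  (forall C D, measurable C -> measurable D ->
     P (W @^-1` C `&` Y @^-1` D) = (P (W @^-1` C) * P (Y @^-1` D))%E) ->
  mean (fun t => W t * Y t) = mean W * mean Y.
Proof.
move=> bW bY WY.
have mWC C : measurable C -> measurable (W @^-1` C).
  by move=> mC; rewrite -[X in measurable X]setTI; case: bW => mW _; exact: mW.
have mYC C : measurable C -> measurable (Y @^-1` C).
  by move=> mC; rewrite -[X in measurable X]setTI; case: bY => mY _; exact: mY.
apply: mean_mul_of_events => // C mC.
have bI : bounded_rv (\1_(W @^-1` C)) by apply: bounded_rv_indic; exact: mWC.
under eq_fun do rewrite mulrC.
rewrite mean_mul_of_events//; first by rewrite mulrC mean_indic//; exact: mWC.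
move=> D mD.
have -> : (fun t => \1_(Y @^-1` D) t * \1_(W @^-1` C) t) =
  (\1_(W @^-1` C `&` Y @^-1` D) : T -> R).
  by apply/funext => t; rewrite indicI mulrC.
rewrite !mean_indic//; [|exact: mWC|by apply: measurableI; [exact: mWC|exact: mYC]].
rewrite WY// fineM ?fin_num_measure//; first by rewrite mulrC.
- exact: mWC.
- exact: mYC.
Qed.
End bounded_expectation.

(** * Sigma-algebras generated by disjoint sets of coordinates *)

Section independence.
Variables (R : realType) (d : measure_display) (T : measurableType d).
Variables (P : probability T R) (I : choiceType) (X : I -> {RV P >-> R}).
Hypothesis indep : mutually_independent X.

(** A pi-system generating the sigma-algebra of the coordinates in [J]. *)
Definition cylinders (J : set I) : set (set T) :=
  [set A | exists (s : seq I) (C : I -> set R), [/\ uniq s,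
    forall i, i \in s -> J i, forall i, measurable (C i)
    & A = \bigcap_(i in [set` s]) (X i @^-1` C i)]].

Definition events (J : set I) : set (set T) := <<s cylinders J >>.

Lemma cylinders_measurable J : cylinders J `<=` measurable.
Proof.
move=> _ [s [C [_ _ mC ->]]].
apply: fin_bigcap_measurable => // i _.
by rewrite -[Y in measurable Y]setTI; exact: measurable_funP.
Qed.

Lemma events_measurable J : events J `<=` measurable.
Proof.
apply: smallest_sub; last exact: cylinders_measurable.
split; [exact: measurable0|by move=> A mA; rewrite setTD; exact: measurableC|].
by move=> F mF; exact: bigcupT_measurable.
Qed.

Lemma cylindersT J : cylinders J setT.
Proof.
by exists [::], (fun=> setT); split => //; rewrite set_nil bigcap_set0.
Qed.

Lemma cylinders_setI J : setI_closed (cylinders J).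
Proof.
move=> _ _ [s [C [us sJ mC ->]]] [s' [C' [us' sJ' mC' ->]]].
exists (undup (s ++ s')), (fun i => (if i \in s then C i else setT) `&`
  (if i \in s' then C' i else setT)); split.
- exact: undup_uniq.
- by move=> i; rewrite mem_undup mem_cat => /orP[/sJ|/sJ'].
- by move=> i; apply: measurableI; case: ifP.
- apply/seteqP; split => t.
    move=> [h1 h2] i _; split => /=.
      by case: ifPn => // /h1.
    by case: ifPn => // /h2.
  move=> h; split => i /= si.
    have /= := h i; rewrite mem_undup mem_cat si => /(_ isT) [].
    by [].
  have /= := h i; rewrite mem_undup mem_cat si orbT => /(_ isT) [_].
  by [].
Qed.

Lemma cylinders_indep J K A B : J `&` K `<=` set0 ->
  cylinders J A -> cylinders K B -> P (A `&` B) = (P A * P B)%E.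
Proof.
move=> JK [s [C [us sJ mC ->]]] [s' [C' [us' sK mC' ->]]].
have dis i : i \in s' -> i \in s = false.
  by move=> /sK Ki; apply/negP => /sJ Ji; exact: (JK i).
pose D i := if i \in s then C i else C' i.
have mD i : measurable (D i) by rewrite /D; case: ifP.
have -> : \bigcap_(i in [set` s]) (X i @^-1` C i) `&`
    \bigcap_(i in [set` s']) (X i @^-1` C' i) =
    \bigcap_(i in [set` s ++ s']) (X i @^-1` D i).
  apply/seteqP; split => t.
    move=> [h1 h2] i; rewrite /= mem_cat /D; case: ifPn => [si _|_ /=]; first exact: h1.
    exact: h2.
  move=> h; split => i /= si.
    by have /= := h i; rewrite mem_cat /D si => /(_ isT).
  by have /= := h i; rewrite mem_cat /D dis// si => /(_ isT).
have us2 : uniq (s ++ s').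
  rewrite cat_uniq us us' andbT /=; apply/hasPn => i /dis.
  by rewrite /= => ->.
rewrite !indep// big_cat /=; congr (_ * _)%E; apply: eq_big_seq => i si.
  by rewrite /D si.
by rewrite /D dis.
Qed.

(** As functions of [A] both sides are finite measures, P restricted to [B] and P scaled by [P B].
    They agree on the pi-system [G], hence on the sigma-algebra it generates. *)
Lemma indep_cylinders_events (G : set (set T)) (B : set T) :
  measurable B -> setI_closed G -> G setT -> G `<=` measurable ->
  (forall A, G A -> P (A `&` B) = (P A * P B)%E) ->
  forall A, <<s G >> A -> P (A `&` B) = (P A * P B)%E.
Proof.
move=> mB GI GT Gm GB A sA.
have pB0 : 0 <= fine (P B) by rewrite fine_ge0.
have -> : (P A * P B)%E = mscale (NngNum pB0) P A.
  by rewrite /mscale /= fineK ?fin_num_measure// muleC.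
have -> : P (A `&` B) = mrestr P mB A by [].
apply: (@g_sigma_algebra_measure_unique _ _ _ G Gm (fun=> setT)) => //.
- by rewrite bigcup_const.
- move=> C GC; apply: etrans (GB _ GC) _.
  by rewrite /= /mscale /= fineK ?fin_num_measure// muleC.
- move=> _; apply: (@le_lt_trans _ _ 1%E); last exact: ltry.
  by apply: (probability_le1 P); exact: measurableI.
Qed.

(** Independence of cylinders is extended first in [B], then in [A]. *)
Lemma events_indep J K A B : J `&` K `<=` set0 ->
  events J A -> events K B -> P (A `&` B) = (P A * P B)%E.
Proof.
move=> JK sA sB.
apply: (indep_cylinders_events (G := cylinders J)) => //.
- exact: events_measurable sB.
- exact: cylinders_setI.
- exact: cylindersT.
- exact: cylinders_measurable.
move=> {sA} {}A cA; rewrite setIC muleC.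
apply: (indep_cylinders_events (G := cylinders K)) => //.
- exact: cylinders_measurable cA.
- exact: cylinders_setI.
- exact: cylindersT.
- exact: cylinders_measurable.
by move=> C cC; rewrite setIC muleC; exact: cylinders_indep cA cC.
Qed.

Lemma sub_events J K : J `<=` K -> events J `<=` events K.
Proof.
move=> JK; apply: smallest_sub; first exact: smallest_sigma_algebra.
move=> A [s [C [us sJ mC ->]]]; apply: sub_sigma_algebra.
by exists s, C; split => // i /sJ /JK.
Qed.

(** Using [g_sigma_algebraType] makes the general closure rules for measurable functions available
    for the sub-sigma-algebra. *)
Definition depends_on (J : set I) (Y : T -> R) :=
  measurable_fun (setT : set (g_sigma_algebraType (cylinders J))) (Y : _ -> R).

Lemma depends_on_preimage J Y C : depends_on J Y -> measurable C ->
  events J (Y @^-1` C).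
Proof. by move=> mY mC; rewrite -[Z in events _ Z]setTI; exact: mY. Qed.

Lemma depends_on_measurable J Y : depends_on J Y -> measurable_fun setT Y.
Proof.
move=> mY _ C mC; rewrite setTI; apply: (@events_measurable J).
exact: depends_on_preimage.
Qed.

Lemma depends_on_comp J i (g : R -> R) : J i -> measurable_fun setT g ->
  depends_on J (g \o X i).
Proof.
move=> Ji mg; apply: (measurableT_comp mg) => _ C mC; rewrite setTI.
apply: sub_sigma_algebra; exists [:: i], (fun=> C); split => //.
  by move=> j; rewrite inE => /eqP ->.
apply/seteqP; split => t /=; first by move=> h j; rewrite /= inE => /eqP ->.
by move=> /(_ i); apply; rewrite /= inE.
Qed.

Lemma sub_depends_on J K Y : J `<=` K -> depends_on J Y -> depends_on K Y.
Proof.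
move=> JK mY _ C mC; rewrite setTI; apply: (sub_events JK).
exact: depends_on_preimage.
Qed.

Lemma mean_mul_depends_on J K W Y : J `&` K `<=` set0 ->
  bounded_rv W -> bounded_rv Y -> depends_on J W -> depends_on K Y ->
  mean P (fun t => W t * Y t) = mean P W * mean P Y.
Proof.
move=> JK bW bY JW KY; apply: mean_mul => // C D mC mD.
by apply: (events_indep JK); exact: depends_on_preimage.
Qed.
End independence.

(** * Stopped random walks *)

Section stopped_walk.
Variables (R : realType) (d : measure_display) (T : measurableType d).
Variables (P : probability T R) (I : choiceType) (X : I -> {RV P >-> R}).
Hypothesis indep : mutually_independent X.
Variables (g : R -> R) (K s2 : R) (site : nat -> I).
Hypothesis mg : measurable_fun setT g.
Hypothesis gK : forall w, `|g w| <= K.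
Hypothesis site_inj : injective site.

Let eta i t := g (X (site i) t).

Hypothesis eta_mean : forall i, mean P (eta i) = 0.
Hypothesis eta_mean2 : forall i, mean P (fun t => eta i t ^+ 2) = s2.
Hypothesis s2_gt0 : 0 < s2.

Definition partial_sum m k t := \sum_(i < k) eta (m + i) t.

Variables (m : nat) (a b : R).
Hypothesis a_gt0 : 0 < a.
Hypothesis b_gt0 : 0 < b.

(** The walk with increments [eta m], [eta (m + 1)], ..., frozen on leaving (-a, b). It is a
    martingale transform: the factor of each increment is determined by the earlier ones. *)
Fixpoint stopped k (t : T) : R :=
  if k is k'.+1 then
    stopped k' t + (- a < stopped k' t < b)%R%:R * eta (m + k') t
  else 0.

Definition alive k t : R := (- a < stopped k t < b)%R%:R.

Definition top k t : R := (b <= stopped k t)%R%:R.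

Definition block k : set I := [set x | exists2 i, (m <= i < m + k)%N & x = site i].

Let K_ge0 : 0 <= K.
Proof. exact: le_trans (normr_ge0 _) (gK 0). Qed.

Let signs : [/\ 0 < a, 0 < b & 0 <= K].
Proof. by []. Qed.

(** The exit step overshoots an end of the interval by at most [K]. *)
Lemma stopped_bound k t : - a - K <= stopped k t <= b + K.
Proof.
have [a0 b0 K0] := signs.
elim: k => [|k IH] /=; first by rewrite /=; apply/andP; split; lra.
have /ler_normlP[h1 h2] := gK (X (site (m + k)) t).
case: (boolP (- a < stopped k t < b)) => [/andP[h3 h4]|_];
  rewrite ?mulr1n ?mulr0n ?mul1r ?mul0r ?addr0//.
by rewrite /eta; apply/andP; split; lra.
Qed.

Lemma sub_block k : block k `<=` block k.+1.
Proof. by move=> _ [i h ->]; exists i => //; lia. Qed.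

Lemma depends_on_alive J k : depends_on X J (stopped k) ->
  depends_on X J (alive k).
Proof.
move=> h; rewrite /depends_on /alive.
rewrite (_ : (fun t => _) =
  (fun t => if (- a < stopped k t) && (stopped k t < b) then 1 else 0)).
  apply: measurable_fun_ifT; try exact: measurable_cst.
  by apply: measurable_and; apply: measurable_fun_ltr => //; exact: measurable_cst.
by apply/funext => t; case: ifP.
Qed.

Lemma depends_on_top J k : depends_on X J (stopped k) ->
  depends_on X J (top k).
Proof.
move=> h; rewrite /depends_on /top.
rewrite (_ : (fun t => _) = (fun t => if (b <= stopped k t) then 1 else 0)).
  apply: measurable_fun_ifT; try exact: measurable_cst.
  by apply: measurable_fun_ler => //; exact: measurable_cst.
by apply/funext => t; case: ifP.
Qed.

Lemma stopped_depends_on k : depends_on X (block k) (stopped k).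
Proof.
elim: k => [|k IH]; first exact: measurable_cst.
have IH' := sub_depends_on (@sub_block k) IH.
apply: measurable_funD => //; apply: measurable_funM.
  exact: depends_on_alive.
by apply: depends_on_comp => //; exists (m + k)%N => //; lia.
Qed.

Lemma bounded_stopped k : bounded_rv (stopped k).
Proof.
split; first exact: depends_on_measurable (@stopped_depends_on k).
have [a0 b0 K0] := signs.
exists (a + b + K) => t; have /andP[h1 h2] := stopped_bound k t.
by rewrite ler_norml; apply/andP; split; lra.
Qed.

Lemma bounded_alive k : bounded_rv (alive k).
Proof.
split; first exact: depends_on_measurable (depends_on_alive (@stopped_depends_on k)).
by exists 1 => t; rewrite /alive; case: (_ && _); rewrite ?normr1 ?normr0.
Qed.

Lemma bounded_top k : bounded_rv (top k).
Proof.
split; first exact: depends_on_measurable (depends_on_top (@stopped_depends_on k)).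
by exists 1 => t; rewrite /top; case: (b <= _); rewrite ?normr1 ?normr0.
Qed.

Lemma bounded_eta i : bounded_rv (eta i).
Proof.
split; last by exists K => t; exact: gK.
apply: measurableT_comp => //.
Qed.

(** [block k] omits the site of the next increment, which is therefore independent of [W]. It is
    used with [h] the identity or the square. *)
Lemma mean_mul_next k (W : T -> R) (h : R -> R) :
  bounded_rv W -> depends_on X (block k) W ->
  measurable_fun setT h -> bounded_rv (fun t => h (eta (m + k) t)) ->
  mean P (fun t => W t * h (eta (m + k) t)) =
  mean P W * mean P (fun t => h (eta (m + k) t)).
Proof.
move=> bW kW mh bh.
apply: (mean_mul_depends_on indep (J := block k) (K := [set site (m + k)])) => //.
  by move=> _ [[i hi ->]] /site_inj ik; move: hi; rewrite ik; lia.
apply: (depends_on_comp (g := h \o g)) => //; exact: measurableT_comp.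
Qed.

Lemma mean_stopped k : mean P (stopped k) = 0.
Proof.
elim: k => [|k IH]; first exact: mean_cst.
have bs := bounded_stopped k; have ba := bounded_alive k.
have be := bounded_eta (m + k).
rewrite /= meanD// ?IH ?add0r; last exact: bounded_rvM.
rewrite (@mean_mul_next k (alive k) id) ?eta_mean ?mulr0//.
exact: depends_on_alive (@stopped_depends_on k).
Qed.

(** In the expanded square the cross term has mean 0, and the indicator [alive] is its own
    square. *)
Lemma mean_stopped2S k : mean P (fun t => stopped k.+1 t ^+ 2) =
  mean P (fun t => stopped k t ^+ 2) + s2 * mean P (alive k).
Proof.
have bs := bounded_stopped k; have ba := bounded_alive k.
have be := bounded_eta (m + k).
have ds := @stopped_depends_on k; have da := depends_on_alive ds.
have be2 : bounded_rv (fun t => eta (m + k) t ^+ 2).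
  by under eq_fun do rewrite expr2; exact: bounded_rvM.
have bs2 : bounded_rv (fun t => stopped k t ^+ 2).
  by under eq_fun do rewrite expr2; exact: bounded_rvM.
have bas : bounded_rv (fun t => alive k t * stopped k t) by exact: bounded_rvM.
have -> : (fun t => stopped k.+1 t ^+ 2) = (fun t => stopped k t ^+ 2 +
    (2 * (alive k t * stopped k t * eta (m + k) t) +
     alive k t * eta (m + k) t ^+ 2)).
  by apply/funext => t /=; rewrite /alive; case: (_ && _) => /=; ring.
rewrite meanD//; last first.
  by apply: bounded_rvD; [apply: bounded_rvZ|]; exact: bounded_rvM.
congr (_ + _); rewrite meanD; last 2 first.
- by apply: bounded_rvZ; exact: bounded_rvM.
- exact: bounded_rvM.
rewrite meanZ; last exact: bounded_rvM.
rewrite (@mean_mul_next k (fun t => alive k t * stopped k t) id)//; last exact: measurable_funM.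
rewrite eta_mean !mulr0 add0r.
rewrite (@mean_mul_next k (alive k) (fun x => x ^+ 2))//.
by rewrite eta_mean2 mulrC.
Qed.

Lemma alive_decr k t : alive k.+1 t <= alive k t.
Proof.
rewrite /alive /=; case: (boolP (- a < stopped k t < b)) => h.
  by rewrite ler_nat leq_b1.
by rewrite mul0r addr0 (negbTE h).
Qed.

(** The second moment grows by [s2] times the mean of [alive] at each step; [alive] decreases in
    time and the stopped walk is bounded. *)
Lemma mean_alive_le k : k%:R * s2 * mean P (alive k) <= (a + b + K) ^+ 2.
Proof.
have [a0 b0 K0] := signs.
have h n : n%:R * s2 * mean P (alive n) <= mean P (fun t => stopped n t ^+ 2).
  elim: n => [|n IH].
    by rewrite !mul0r; apply: Rintegral_ge0 => t _; exact: sqr_ge0.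
  rewrite mean_stopped2S -natr1.
  have al : mean P (alive n.+1) <= mean P (alive n).
    by apply: le_mean; [exact: bounded_alive|exact: bounded_alive|exact: alive_decr].
  apply: (@le_trans _ _ ((n%:R + 1) * s2 * mean P (alive n))).
    by rewrite ler_wpM2l// mulr_ge0 ?(ltW s2_gt0)//; have := ler0n R n; lra.
  by lra.
apply: le_trans (h k) _; rewrite -(mean_cst P ((a + b + K) ^+ 2)).
have bs := bounded_stopped k.
apply: le_mean; [|exact: bounded_rv_cst|].
  by under eq_fun do rewrite expr2; exact: bounded_rvM.
move=> t; have /andP[h1 h2] := stopped_bound k t.
rewrite -real_normK ?num_real// lerXn2r ?nnegrE//; first by lra.
by rewrite ler_norml; apply/andP; split; lra.
Qed.

(** Optional stopping: pointwise, the stopped walk is at most [- a + (a + b + K) (top + alive)], and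
    its mean is 0. *)
Lemma mean_top_ge k : a <= (a + b + K) * (mean P (top k) + mean P (alive k)).
Proof.
have [a0 b0 K0] := signs.
have bt := bounded_top k; have ba := bounded_alive k.
have : mean P (stopped k) <= mean P (fun t => - a + (a + b + K) * (top k t + alive k t)).
  apply: le_mean.
  - exact: bounded_stopped.
  - by apply: bounded_rvD; [exact: bounded_rv_cst|apply: bounded_rvZ; exact: bounded_rvD].
  move=> t; have /andP[h1 h2] := stopped_bound k t.
  rewrite /top /alive; case: (leP b (stopped k t)) => hb /=; rewrite ?andbF ?andbT /=; first lra.
  by case: (ltP (- a) (stopped k t)) => ha /=; lra.
rewrite mean_stopped meanD; last 2 first.
- exact: bounded_rv_cst.
- by apply: bounded_rvZ; exact: bounded_rvD.
rewrite mean_cst meanZ; last exact: bounded_rvD.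
by rewrite meanD//; lra.
Qed.

Lemma top_event k : events X (block k) [set t | b <= stopped k t].
Proof.
have -> : [set t | b <= stopped k t] = (stopped k) @^-1` `[b, +oo[%classic.
  by apply/seteqP; split => t /=; rewrite in_itv /= andbT.
by apply: depends_on_preimage; [exact: stopped_depends_on|exact: measurable_itv].
Qed.

Lemma prob_top_ge k : (0 < k)%N ->
  a / (a + b + K) - (a + b + K) ^+ 2 / (k%:R * s2) <=
  fine (P [set t | b <= stopped k t]).
Proof.
move=> k0; have [a0 b0 K0] := signs.
have D0 : 0 < a + b + K by lra.
have mtop : measurable [set t | b <= stopped k t].
  exact: (events_measurable (@top_event k)).
rewrite -mean_indic//.
have -> : \1_[set t | b <= stopped k t] = top k.
  apply/funext => t; rewrite indicE /top; congr (nat_of_bool _)%:R.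
  by apply/idP/idP; rewrite inE.
have h1 : a / (a + b + K) <= mean P (top k) + mean P (alive k).
  by rewrite ler_pdivrMr// mulrC; exact: mean_top_ge.
have h2 : mean P (alive k) <= (a + b + K) ^+ 2 / (k%:R * s2).
  rewrite ler_pdivlMr ?mulr_gt0 ?ltr0n//.
  by rewrite mulrC; exact: mean_alive_le.
by lra.
Qed.

(** The witness [j] is the smaller of [k] and the exit time; the last clause carries the
    induction. *)
Lemma stopped_path k t : exists2 j, (j <= k)%N &
  [/\ stopped k t = partial_sum m j t,
      forall i, (i < j)%N -> - a < partial_sum m i t
    & - a < stopped k t < b -> j = k].
Proof.
elim: k => [|k [j jk [Sj ja al]]].
  by exists 0%N => //; split => //; rewrite /partial_sum big_ord0.
have [h|h] := boolP (- a < stopped k t < b).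
  exists k.+1 => //; split => //.
    by rewrite /= h Sj (al h) /partial_sum big_ord_recr /= mul1r.
  move=> i; rewrite ltnS leq_eqVlt => /orP[/eqP ->|ik].
    by case/andP: (h); rewrite Sj (al h).
  by apply: ja; rewrite (al h).
exists j; first exact: leqW.
by rewrite /= (negbTE h) mul0r addr0; split => // h'; rewrite h' in h.
Qed.

Lemma top_path k t : b <= stopped k t -> exists j, [/\ (0 < j <= k)%N,
  b <= partial_sum m j t & forall i, (i <= j)%N -> - a <= partial_sum m i t].
Proof.
have [a0 b0 _] := signs.
move=> bk; have [j jk [Sj ja _]] := stopped_path k t.
rewrite Sj in bk; exists j; split => //.
  rewrite jk andbT lt0n; apply/eqP => j0; move: bk.
  by rewrite j0 /partial_sum big_ord0; lra.
move=> i; rewrite leq_eqVlt => /orP[/eqP ->|/ja/ltW//].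
by lra.
Qed.
End stopped_walk.

(** * Valleys of the potential *)

(** Taking L of order exp(2n) balances the two terms: 2n - 11n/4 and 5n/4 - 2n are both -3n/4. *)
Lemma valley_energy (R : realType) (v w : nat -> R) (n : R) (N j k : nat) :
  0 <= n -> (j <= N)%N -> (k <= N)%N ->
  11 * n / 4 <= v j -> 11 * n / 4 <= w k ->
  (forall i, (i <= j)%N -> - (5 * n / 4) <= v i) ->
  (forall i, (i <= k)%N -> - (5 * n / 4) <= w i) ->
  exists L : nat, (0 < L)%N /\
    L%:R * (expR (- v j) + expR (- w k)) +
    (\sum_(i < j.+1) expR (- v i) + \sum_(i < k.+1) expR (- w i)) / L%:R <=
    (2 * N%:R + 6) * expR (- (3 * n / 4)).
Proof.
move=> n0 jN kN vj wk vi wi.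
pose L := (Num.truncn (expR (2 * n))).+1.
have e0 : 0 <= expR (2 * n) by exact: expR_ge0.
have /andP[L1 L2] := Num.Theory.truncn_itv e0; rewrite -/L in L2.
have L3 : L%:R <= 2 * expR (2 * n).
  have : 1 <= expR (2 * n) by have := expR_ge1Dx (2 * n); lra.
  by rewrite /L -natr1; lra.
have L0 : 0 < L%:R :> R by rewrite ltr0n.
exists L; split => //.
have vj' : expR (- v j) <= expR (- (11 * n / 4)) by rewrite ler_expR; lra.
have wk' : expR (- w k) <= expR (- (11 * n / 4)) by rewrite ler_expR; lra.
have sum_le (u : nat -> R) (l : nat) : (l <= N)%N ->
    (forall i, (i <= l)%N -> - (5 * n / 4) <= u i) ->
    \sum_(i < l.+1) expR (- u i) <= (N%:R + 1) * expR (5 * n / 4).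
  move=> lN ui; apply: (@le_trans _ _ (\sum_(i < l.+1) expR (5 * n / 4))).
    apply: ler_sum => i _; rewrite ler_expR.
    by have := ui i; rewrite -ltnS ltn_ord => /(_ isT); lra.
  rewrite sumr_const card_ord -[leLHS]mulr_natl ler_wpM2r ?expR_ge0//.
  by rewrite natr1 ler_nat ltnS.
have E1 : expR (2 * n) * expR (- (11 * n / 4)) = expR (- (3 * n / 4)).
  by rewrite -expRD; congr expR; field.
have E2 : expR (5 * n / 4) = expR (- (3 * n / 4)) * expR (2 * n).
  by rewrite -expRD; congr expR; field.
have h1 : L%:R * (expR (- v j) + expR (- w k)) <= 4 * expR (- (3 * n / 4)).
  rewrite -E1; apply: (@le_trans _ _ (L%:R * (2 * expR (- (11 * n / 4))))).
    by rewrite ler_wpM2l ?(ltW L0)//; lra.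
  have := ler_wpM2r (expR_ge0 (- (11 * n / 4))) L3; lra.
have h2 : (\sum_(i < j.+1) expR (- v i) + \sum_(i < k.+1) expR (- w i)) / L%:R
    <= (2 * N%:R + 2) * expR (- (3 * n / 4)).
  rewrite ler_pdivrMr//; have := sum_le _ _ jN vi; have := sum_le _ _ kN wi.
  have N0 : 0 <= (N%:R + 1) * expR (- (3 * n / 4)).
    by rewrite mulr_ge0 ?expR_ge0// addr_ge0.
  have := ler_wpM2l N0 (ltW L2); rewrite E2; lra.
by lra.
Qed.

Lemma quadratic_lt_exp (R : realType) (C1 C2 M eps : R) :
  0 <= C1 -> 0 <= C2 -> 0 <= M -> 0 < eps -> exists n : R,
    [/\ 1 <= n, M <= n & (C1 + C2 * n ^+ 2) * expR (- (3 * n / 4)) < eps].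
Proof.
(* The proof bounds exp(3n/4) below by (n/4)^3 = n^3/64, which explains the 64; the excess power of
   [n] absorbs [(C1 + C2) / eps]. *)
move=> C10 C20 M0 e0; pose n := 1 + M + 64 * (C1 + C2) / eps.
have q0 : 0 <= 64 * (C1 + C2) / eps.
  by rewrite divr_ge0 ?(ltW e0)// mulr_ge0// addr_ge0.
have n1 : 1 <= n by rewrite /n; lra.
exists n; split => //; first by rewrite /n; lra.
rewrite expRN ltr_pdivrMr ?expR_gt0//.
have -> : expR (3 * n / 4) = expR (n / 4) ^+ 3.
  by rewrite -expRM_natl; congr expR; lra.
have h1 : n / 4 < expR (n / 4) by have := expR_ge1Dx (n / 4); lra.
have h3 : (n / 4) ^+ 3 < expR (n / 4) ^+ 3.
  by rewrite ltrXn2r// ?nnegrE ?expR_ge0//; lra.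
have h4 : 64 * (C1 + C2) <= eps * n.
  have -> : 64 * (C1 + C2) = eps * (64 * (C1 + C2) / eps).
    by field; rewrite gt_eqF.
  by rewrite ler_pM2l// /n; lra.
have n2 : 1 <= n ^+ 2 by rewrite expr_ge1//; lra.
have h5 : C1 <= C1 * n ^+ 2 by rewrite -[leLHS]mulr1 ler_wpM2l.
have h6 : (64 * (C1 + C2)) * n ^+ 2 <= eps * n * n ^+ 2.
  by rewrite ler_wpM2r//; lra.
have h7 : eps * (n / 4) ^+ 3 < eps * expR (n / 4) ^+ 3 by rewrite ltr_pM2l.
apply: le_lt_trans h7.
have -> : eps * (n / 4) ^+ 3 = eps * n * n ^+ 2 / 64 by field.
by lra.
Qed.

(** * A climb on one side beyond an explored window *)

Section one_side.
Variables (R : realType) (d : measure_display) (T : measurableType d).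
Variables (P : probability T R) (I : choiceType) (X : I -> {RV P >-> R}).
Hypothesis indep : mutually_independent X.
Variables (g : R -> R) (K s2 : R) (site : nat -> I).
Hypothesis mg : measurable_fun setT g.
Hypothesis gK : forall w, `|g w| <= K.
Hypothesis site_inj : injective site.
Hypothesis step_mean0 : forall i, mean P (fun t => g (X (site i) t)) = 0.
Hypothesis step_mean2 : forall i, mean P (fun t => g (X (site i) t) ^+ 2) = s2.
Hypothesis s2_gt0 : 0 < s2.

(** The first [N0] steps move the walk by at most n/4. The event only asks the next [N] steps to
    leave (-n, 3n) at the top, so it does not look at the explored sites; the levels become 3n - n/4
    and -n - n/4. *)
Lemma climb_event (N0 N : nat) (n : R) : 0 < n -> K <= n -> 4 * K * N0%:R <= n ->
  250 * n ^+ 2 <= N%:R * s2 ->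
  exists E, [/\ events X (block site N0 N) E, 1 / 10 <= fine (P E) &
    forall t, E t -> exists k, [/\ (0 < k <= N0 + N)%N,
      11 * n / 4 <= partial_sum X g site 0 k t &
      forall i, (i <= k)%N -> - (5 * n / 4) <= partial_sum X g site 0 i t]].
Proof.
move=> n0 Kn KN hN; have n30 : 0 < 3 * n by lra.
have K0 : 0 <= K by exact: le_trans (normr_ge0 _) (gK 0).
have n2 : 0 < n ^+ 2 by rewrite exprn_gt0.
have Ns : 0 < N%:R * s2 by lra.
have N_gt0 : (0 < N)%N.
  by rewrite lt0n; apply/eqP => h; move: Ns; rewrite h mul0r ltxx.
exists [set t | 3 * n <= stopped X g site N0 n (3 * n) N t]; split.
- exact: top_event.
- apply: le_trans (prob_top_ge indep mg gK site_inj step_mean0 step_mean2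
    s2_gt0 N0 n0 n30 N_gt0).
  (* As [4 n + K <= 5 n], the exit bound is at least 1/5 - 25/250 = 1/10. *)
  have h1 : 1 / 5 <= n / (n + 3 * n + K) by rewrite ler_pdivlMr; lra.
  have h2 : (n + 3 * n + K) ^+ 2 / (N%:R * s2) <= 1 / 10.
    rewrite ler_pdivrMr//; apply: (@le_trans _ _ ((5 * n) ^+ 2)).
      by rewrite lerXn2r// ?nnegrE; lra.
    by rewrite exprMn; lra.
  by lra.
have psD i t : partial_sum X g site 0 (N0 + i) t =
    partial_sum X g site 0 N0 t + partial_sum X g site N0 i t.
  by rewrite /partial_sum big_split_ord.
have psK i t : (i <= N0)%N -> `|partial_sum X g site 0 i t| <= n / 4.
  move=> iN; apply: (@le_trans _ _ (K * N0%:R)); last by lra.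
  apply: (@le_trans _ _ (K * i%:R)); last by rewrite ler_wpM2l// ler_nat.
  elim: i {iN} => [|i IH]; first by rewrite /partial_sum big_ord0 normr0 mulr0.
  rewrite /partial_sum big_ord_recr /= -natr1 mulrDr mulr1.
  by apply: le_trans (ler_normD _ _) _; apply: lerD.
move=> t /= /(top_path gK n0 n30) [j [/andP[j0 jN] tj pj]].
exists (N0 + j)%N; split.
- by rewrite addn_gt0 j0 orbT leq_add2l.
- by rewrite psD; have /ler_normlP[] := psK N0 t (leqnn _); lra.
move=> i ij; case: (leqP i N0) => iN.
  by have /ler_normlP[] := psK i t iN; lra.
rewrite -(subnKC (ltnW iN)) psD; have /ler_normlP[h1 h2] := psK N0 t (leqnn _).
by have := pj (i - N0)%N; rewrite leq_subLR => /(_ ij); lra.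
Qed.
End one_side.

(** * Simultaneous climbs on both sides, at infinitely many scales *)

Section two_sides.
Variables (R : realType) (d : measure_display) (T : measurableType d).
Variables (P : probability T R) (omega : int -> {RV P >-> R}).
Hypothesis indep : mutually_independent omega.
Variables (g : R -> R) (K s2 : R).
Hypothesis mg : measurable_fun setT g.
Hypothesis gK : forall w, `|g w| <= K.
Hypothesis g_mean0 : forall x, mean P (fun t => g (omega x t)) = 0.
Hypothesis g_mean2 : forall x, mean P (fun t => g (omega x t) ^+ 2) = s2.
Hypothesis s2_gt0 : 0 < s2.

(** With V(0) = 0, V(k) adds the increments at 1, ..., k, while V(-k) subtracts those at 0, -1, ...,
    1 - k. This gives the shift between the two sides and the sign in [left_potential]. *)
Definition right_site (i : nat) : int := i.+1%:Z.
Definition left_site (i : nat) : int := - i%:Z.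

Lemma right_site_inj : injective right_site.
Proof. by move=> i j; rewrite /right_site; lia. Qed.

Lemma left_site_inj : injective left_site.
Proof. by move=> i j; rewrite /left_site; lia. Qed.

Definition right_potential k t := partial_sum omega g right_site 0 k t.
Definition left_potential k t := partial_sum omega (fun w => - g w) left_site 0 k t.

(** The bracket dominates the energy bound of [mass0_escape_le] with [a = j - 1] and [b = k], which
    is why [j] is positive; site 0 is counted in both sums. *)
Definition valley (eps : R) : set T := [set t | exists j k L : nat,
  [/\ (0 < j)%N, (0 < L)%N &
    L%:R * (expR (- left_potential j t) + expR (- right_potential k t)) +
    (\sum_(i < j.+1) expR (- left_potential i t) +
     \sum_(i < k.+1) expR (- right_potential i t)) / L%:R < eps]].

Let inside (N : nat) : set int := [set x | - N%:Z < x <= N%:Z].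

Let bounded_g x : bounded_rv (fun t => g (omega x t)).
Proof.
split; last by exists K => t; exact: gK.
exact: measurableT_comp.
Qed.

Let block_right N0 N :
  block right_site N0 N `<=` inside (N0 + N) `\` inside N0.
Proof.
by move=> _ [i hi ->]; rewrite /inside /right_site; split => /=; lia.
Qed.

Let block_left N0 N :
  block left_site N0 N `<=` inside (N0 + N) `\` inside N0.
Proof.
by move=> _ [i hi ->]; rewrite /inside /left_site; split => /=; lia.
Qed.

Let block_disjoint N0 N :
  block right_site N0 N `&` block left_site N0 N `<=` set0.
Proof.
by move=> _ [[i hi ->]] [j hj]; rewrite /right_site /left_site; lia.
Qed.

Let sub_inside N N1 : (N <= N1)%N -> inside N `<=` inside N1.
Proof. by move=> h x; rewrite /inside /=; lia. Qed.

(** The window [N0] is given first and [n] is chosen large compared with it. The two climbs use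
    disjoint sets of fresh sites, so their probabilities multiply. *)
Lemma valley_block (eps : R) (N0 : nat) : 0 < eps -> exists N1 E,
  [/\ (N0 <= N1)%N, events omega (inside N1 `\` inside N0) E,
      1 / 100 <= fine (P E) & E `<=` valley eps].
Proof.
move=> eps0; have s20 := s2_gt0.
have K0 : 0 <= K by exact: le_trans (normr_ge0 _) (gK 0).
(* The prefactor [2 (N0 + N) + 6] is at most [C1 + C2 n^2] when [N <= 250 n^2 / s2 + 1]. *)
pose C1 : R := 2 * N0%:R + 8; pose C2 : R := 500 / s2.
have C10 : 0 <= C1 by rewrite /C1; have := ler0n R N0; lra.
have C20 : 0 <= C2 by rewrite divr_ge0// ltW.
have KN0 : 0 <= 4 * K * N0%:R by rewrite !mulr_ge0.
have [n [n1 Mn small]] := quadratic_lt_exp C10 C20 (addr_ge0 K0 KN0) eps0.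
have n0 : 0 < n by lra.
have q0 : 0 <= 250 * n ^+ 2 / s2.
  by rewrite divr_ge0 ?(ltW s20)// mulr_ge0// sqr_ge0.
pose N := (Num.truncn (250 * n ^+ 2 / s2)).+1.
have /andP[N1 N2] := Num.Theory.truncn_itv q0; rewrite -/N in N2.
have N3 : 250 * n ^+ 2 <= N%:R * s2 by rewrite -ler_pdivrMr// ltW.
have N4 : N%:R <= 250 * n ^+ 2 / s2 + 1 by rewrite /N -natr1; lra.
have Kn : K <= n by lra.
have KNn : 4 * K * N0%:R <= n by lra.
have [E1 [evE1 pE1 E1P]] := climb_event indep mg gK right_site_inj
  (fun i => g_mean0 (right_site i)) (fun i => g_mean2 (right_site i))
  s20 n0 Kn KNn N3.
have gK' w : `|- g w| <= K by rewrite normrN.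
have mg' : measurable_fun setT (fun w => - g w) by exact: measurable_funN.
have gm0 i : mean P (fun t => - g (omega (left_site i) t)) = 0.
  under eq_fun do rewrite -mulN1r.
  by rewrite meanZ ?g_mean0 ?mulr0.
have gm2 i : mean P (fun t => (- g (omega (left_site i) t)) ^+ 2) = s2.
  by under eq_fun do rewrite sqrrN.
have [E2 [evE2 pE2 E2P]] := climb_event indep mg' gK' left_site_inj gm0 gm2
  s20 n0 Kn KNn N3.
exists (N0 + N)%N, (E1 `&` E2); split.
- exact: leq_addr.
- apply: (@measurableI _ (g_sigma_algebraType (cylinders omega
    (inside (N0 + N) `\` inside N0)))).
    exact: (sub_events (@block_right N0 N)).
  exact: (sub_events (@block_left N0 N)).
- rewrite (events_indep indep (@block_disjoint N0 N) evE1 evE2).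
  have m1 := events_measurable evE1; have m2 := events_measurable evE2.
  rewrite fineM ?fin_num_measure//.
  have -> : 1 / 100 = 1 / 10 * (1 / 10) :> R by field.
  by apply: ler_pM => //; lra.
move=> t [/E1P [k [/andP[k0 kN] kt ki]] /E2P [j [/andP[j0 jN] jt ji]]].
have [L [L0 Lt]] := @valley_energy _ (left_potential^~ t) (right_potential^~ t) n
  (N0 + N) j k (ltW n0) jN kN jt kt ji ki.
exists j, k, L; split => //; apply: le_lt_trans Lt _.
apply: le_lt_trans small; rewrite ler_wpM2r ?expR_ge0// /C1 /C2 natrD.
have -> : 500 / s2 * n ^+ 2 = 2 * (250 * n ^+ 2 / s2).
  by field; rewrite gt_eqF.
by lra.
Qed.

Let pC A : measurable A -> fine (P (~` A)) = 1 - fine (P A).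
Proof. by move=> mA; rewrite probability_setC// fineB ?fin_num_measure. Qed.

(** Each new block avoids the sites used so far, so its failure is independent of the previous ones
    and costs a factor 99/100. *)
Lemma valley_prob (eps : R) (m : nat) : 0 < eps -> exists N A,
  [/\ events omega (inside N) A, fine (P (~` A)) <= (99 / 100) ^+ m
    & A `<=` valley eps].
Proof.
move=> eps0; elim: m => [|m [N [A [evA pA Av]]]].
  exists 0%N, set0; split => //; first exact: sigma_algebra0.
  by rewrite pC// measure0 expr0 subr0.
have [N1 [E [NN1 evE pE Ev]]] := valley_block N eps0.
have evA1 : events omega (inside N1) A.
  exact: (sub_events (sub_inside NN1)).
have evE1 : events omega (inside N1) E by apply: sub_events evE => x [].
have mA := events_measurable evA; have mE := events_measurable evE.
exists N1, (A `|` E); split; last by move=> t [/Av|/Ev].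
  exact: (@measurableU _ (g_sigma_algebraType (cylinders omega (inside N1)))).
have evCA : events omega (inside N) (~` A).
  exact: (@measurableC _ (g_sigma_algebraType (cylinders omega (inside N)))).
have evCE : events omega (inside N1 `\` inside N) (~` E).
  exact: (@measurableC _ (g_sigma_algebraType (cylinders omega (inside N1 `\` inside N)))).
rewrite setCU (events_indep indep _ evCA evCE); last by move=> x [? []].
have mCA := events_measurable evCA; have mCE := events_measurable evCE.
rewrite fineM ?fin_num_measure// exprSr.
by apply: ler_pM; rewrite ?fine_ge0// pC//; lra.
Qed.

Lemma valley_ae (eps : R) : 0 < eps -> P.-negligible (~` valley eps).
Proof.
move=> eps0.
have /choice [A_ hA] : forall m, exists A : set T, [/\ measurable A,
    fine (P (~` A)) <= (99 / 100) ^+ m & A `<=` valley eps].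
  move=> m; have [N [A [evA pA Av]]] := valley_prob m eps0.
  by exists A; split => //; exact: events_measurable evA.
pose B := \bigcap_m ~` A_ m.
have mB : measurable B.
  by apply: bigcapT_measurable => m; apply: measurableC; case: (hA m).
exists B; split => //; last first.
  by move=> t ntv m _ /= Am; apply: ntv; case: (hA m) => _ _; apply.
have PBm m : fine (P B) <= (99 / 100) ^+ m.
  have [mA pA _] := hA m; apply: le_trans pA.
  rewrite fine_le ?fin_num_measure//; [exact: measurableC|].
  apply: le_measure; rewrite ?inE//; first exact: measurableC.
  by move=> t /(_ m); apply.
apply/eqP; rewrite eq_le measure_ge0 andbT -[leLHS]fineK ?fin_num_measure// lee_fin.
have cv : (fun m => (99 / 100 : R) ^+ m) @ \oo --> (0 : R).
  by apply: cvg_expr; rewrite ger0_norm; lra.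
rewrite -(cvg_lim _ cv)//; apply: limr_ge; first by apply/cvg_ex; exists 0.
exact: nearW.
Qed.

Lemma valley_ae_all :
  {ae P, forall t, forall eps : R, 0 < eps -> valley eps t}.
Proof.
have h k : P.-negligible (~` valley k.+1%:R^-1) by apply: valley_ae.
apply: negligibleS (negligible_bigcup h) => t /= nt; apply: contrapT => nb.
apply: nt => eps eps0.
pose k := Num.truncn eps^-1.
have ie0 : 0 <= eps^-1 by rewrite invr_ge0 ltW.
have /andP[_ k2] := Num.Theory.truncn_itv ie0; rewrite -/k in k2.
have : valley k.+1%:R^-1 t.
  by apply: contrapT => nv; apply: nb; exists k.
move=> [j [l [L [j0 L0 lt]]]]; exists j, l, L; split => //.
by apply: lt_trans lt _; rewrite invf_plt ?posrE// ?ltr0n.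
Qed.
End two_sides.

(** * The environment *)

Section conductances.
Variables (R : realType) (d : measure_display) (T : measurableType d).
Variables (P : probability T R) (omega : int -> {RV P >-> R}) (g : R -> R).
Variable t : T.
Hypothesis omega01 : forall x, 0 < omega x t < 1.
Hypothesis g_log : forall x, g (omega x t) = ln (rho (omega x t)).

(** This is exp(-V(x)); [Negz k] is the integer -(k + 1). *)
Definition conductance (x : int) : R :=
  match x with
  | Posz k => expR (- right_potential omega g k t)
  | Negz k => expR (- left_potential omega g k.+1 t)
  end.

Lemma conductance_gt0 x : 0 < conductance x.
Proof. by case: x => k; exact: expR_gt0. Qed.

Let expR_g x : expR (g (omega x t)) * omega x t = 1 - omega x t.
Proof.
have /andP[w0 w1] := omega01 x.
by rewrite g_log lnK ?posrE /rho ?divfK ?gt_eqF// divr_gt0//; lra.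
Qed.

(** In each case this is exp(V(x) - V(x-1)) = rho(omega x); at [x = 0] the step joins the two
    one-sided sums. *)
Lemma conductance_balance x :
  conductance x * (1 - omega x t) = conductance (x - 1) * omega x t.
Proof.
case: x => [[|k]|k].
- rewrite -expR_g (_ : 0%:Z - 1 = Negz 0)// /conductance /right_potential.
  rewrite /left_potential /partial_sum !(big_ord_recl, big_ord0) /= addr0 !oppr0.
  by rewrite expR0 mul1r opprK /left_site oppr0.
- rewrite -expR_g (_ : k.+1%:Z - 1 = k%:Z); last by lia.
  rewrite /conductance /right_potential /partial_sum big_ord_recr /= add0n /right_site.
  by rewrite mulrA -expRD opprD addrNK.
- rewrite -expR_g (_ : Negz k - 1 = Negz k.+1); last by lia.
  rewrite /conductance /left_potential /partial_sum [in RHS]big_ord_recr /= add0n.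
  rewrite mulrA -expRD opprD opprK; congr (expR (_ + g (omega _ t)) * _).
Qed.

Lemma sum_conductance_le (j k : nat) :
  \sum_(i < (j + k).+2) conductance (i%:Z - j.+1%:Z) <=
  \sum_(i < j.+2) expR (- left_potential omega g i t) +
  \sum_(i < k.+1) expR (- right_potential omega g i t).
Proof.
rewrite -addSn -addnS big_split_ord /=; apply: lerD; last first.
  apply: ler_sum => i _; rewrite le_eqVlt; apply/orP; left; apply/eqP.
  by rewrite (_ : (j.+1 + i)%N%:Z - j.+1%:Z = i%:Z)//; lia.
(* The term [i = 0] counts site 0 a second time and is dropped; the remaining sum is reversed to run
   from -1 down to -(j + 1). *)
rewrite [leRHS]big_ord_recl /= -[leLHS]add0r; apply: lerD; first exact: expR_ge0.
rewrite (reindex_inj rev_ord_inj) /=; apply: ler_sum => i _.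
have li := ltn_ord i.
rewrite le_eqVlt; apply/orP; left; apply/eqP.
by rewrite (_ : (j.+1 - i.+1)%N%:Z - j.+1%:Z = Negz i)//; lia.
Qed.

Lemma valleys_recurrent (delta : R) : 0 < delta < 1 ->
  (forall eps : R, 0 < eps -> valley omega g eps t) ->
  rwre_recurrent delta (fun x => omega x t).
Proof.
move=> delta01 v d' T' P' Z chain.
apply: (escape0_returns omega01 delta01 chain).
apply: (escape_eq0 omega01 delta01 conductance_gt0 conductance_balance).
move=> eps /v [j [k [L [j0 L0 lt]]]].
case: j j0 lt => // j _ lt; exists j, k, L; split => //.
apply: le_lt_trans lt; rewrite -NegzE /=; apply: lerD => //.
by rewrite ler_wpM2r ?invr_ge0// sum_conductance_le.
Qed.
End conductances.

(** * A bounded version of log rho *)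

Section clipped_log.
Variables (R : realType) (K : R).

(** Clipping makes the increments bounded at every point, while the value log rho is kept wherever
    ellipticity holds. *)
Definition clipped_log (w : R) : R :=
  Num.max (- K) (Num.min K (ln (1 - w) - ln w)).

Lemma measurable_clipped_log : measurable_fun setT clipped_log.
Proof.
apply: measurable_maxr; first exact: measurable_cst.
apply: measurable_minr; first exact: measurable_cst.
apply: measurable_funB; last exact: measurable_ln.
apply: measurableT_comp; first exact: measurable_ln.
by apply: measurable_funB; [exact: measurable_cst|exact: measurable_id].
Qed.

Lemma clipped_log_bound w : 0 <= K -> `|clipped_log w| <= K.
Proof.
move=> K0; rewrite ler_norml /clipped_log le_max lexx /=.
by rewrite ge_max ge_min lexx /=; apply/andP; split => //; lra.
Qed.

Lemma clipped_logE w : `|ln (1 - w) - ln w| <= K ->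
  clipped_log w = ln (1 - w) - ln w.
Proof.
rewrite ler_norml => /andP[h1 h2].
by rewrite /clipped_log min_r// max_r.
Qed.
End clipped_log.

Lemma ln_rhoE (R : realType) (w : R) : 0 < w < 1 -> ln (rho w) = ln (1 - w) - ln w.
Proof. by move=> /andP[w0 w1]; rewrite /rho ln_div ?posrE//; lra. Qed.

(** Both means are integrals of [h] against the common law. *)
Lemma mean_ident (R : realType) (d : measure_display) (T : measurableType d)
    (P : probability T R) (I : choiceType) (X : I -> {RV P >-> R}) (h : R -> R)
    (x y : I) :
  identically_distributed X -> measurable_fun setT h ->
  (exists M : R, forall w, `|h w| <= M) ->
  mean P (fun t => h (X x t)) = mean P (fun t => h (X y t)).
Proof.
move=> ident mh [M hM].
have b z : bounded_rv (fun t => h (X z t)).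
  by split; [exact: measurableT_comp|exists M => t; exact: hM].
have E z : mean P (fun t => h (X z t)) = fine (\int[distribution P (X z)]_w (h w)%:E)%E.
  rewrite integral_distribution//; first exact/measurable_EFinP.
  exact: bounded_rv_integrable (b z).
by rewrite !E; congr fine; apply: eq_measure_integral => A mA _; exact: ident.
Qed.

Unset Implicit Arguments.

Theorem corollary6p7 (R : realType) (d : measure_display)
    (T : measurableType d) (P : probability T R)
    (omega : int -> {RV P >-> R}) (delta : R)
    (omega01 : forall (x : int) (t : T), 0 < omega x t < 1)
    (indep : mutually_independent omega)
    (ident : identically_distributed omega)
    (mean0 : ('E_P[fun t => ln (rho (omega 0%R t))] = 0)%E)
    (elliptic : exists eps : R, 0 < eps < 1 / 2 /\
       P [set t | eps <= omega 0 t <= 1 - eps] = 1%E)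
    (var_gt0 : (0 < 'V_P[fun t => ln (rho (omega 0%R t))])%E)
    (delta01 : 0 < delta < 1) :
  {ae P, forall t, rwre_recurrent delta (fun x : int => omega x t)}.
Proof.
have [eps [/andP[eps0 eps1] Peps]] := elliptic.
(* The bound for |log rho| on the band [eps, 1 - eps]. *)
pose K : R := ln (1 - eps) - ln eps.
pose g := clipped_log K.
have K0 : 0 <= K by rewrite subr_ge0 ler_ln ?posrE//; lra.
have gK w : `|g w| <= K by exact: clipped_log_bound.
have mg : measurable_fun setT g by exact: measurable_clipped_log.
pose L t := ln (rho (omega 0 t)).
have gE x t : eps <= omega x t <= 1 - eps -> g (omega x t) = ln (rho (omega x t)).
  move=> /andP[h1 h2]; rewrite ln_rhoE// /g clipped_logE// /K.
  have w0 : 0 < omega x t by lra.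
  have := ler_ln (x := eps) (y := omega x t); rewrite !posrE => /(_ eps0 w0).
  rewrite h1 => e1.
  have e2 : ln (1 - omega x t) <= ln (1 - eps) by rewrite ler_ln ?posrE//; lra.
  have e3 : ln (omega x t) <= ln (1 - eps) by rewrite ler_ln ?posrE//; lra.
  have e4 : ln eps <= ln (1 - omega x t) by rewrite ler_ln ?posrE//; lra.
  by rewrite ler_norml; apply/andP; split; lra.
have mband x : measurable [set t | eps <= omega x t <= 1 - eps].
  have -> : [set t | eps <= omega x t <= 1 - eps] =
      omega x @^-1` `[eps, 1 - eps]%classic.
    by apply/seteqP; split => t /=; rewrite in_itv.
  by rewrite -[Y in measurable Y]setTI; apply: measurable_funP => //; exact: measurable_itv.
(* Ellipticity is given at site 0; the common law carries it to every site. *)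
have Pband x : P.-negligible (~` [set t | eps <= omega x t <= 1 - eps]).
  apply/negligibleP; first exact: measurableC.
  apply: etrans (probability_setC P (mband x)) _.
  have -> : P [set t | eps <= omega x t <= 1 - eps] = 1%E.
    have := ident x 0 `[eps, 1 - eps]%classic (measurable_itv _).
    rewrite /distribution /pushforward /= => h.
    have E y : [set t | eps <= omega y t <= 1 - eps] =
      omega y @^-1` `[eps, 1 - eps]%classic.
      by apply/seteqP; split => t /=; rewrite in_itv.
    by rewrite E h -E.
  by rewrite subee.
have gL : {ae P, forall t, g (omega 0 t) = L t}.
  by apply: negligibleS (Pband 0) => t /= h1 h2; apply: h1; exact: gE.
have mL : measurable_fun setT L.
  rewrite /L; under eq_fun do rewrite ln_rhoE//.
  apply: measurable_funB; last by apply: measurableT_comp => //; exact: measurable_ln.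
  apply: measurableT_comp; first exact: measurable_ln.
  by apply: measurable_funB => //; exact: measurable_cst.
have bg x : bounded_rv (fun t => g (omega x t)).
  by split; [exact: measurableT_comp|exists K => t; exact: gK].
have gm0 x : mean P (fun t => g (omega x t)) = 0.
  rewrite (mean_ident (h := g) x 0 ident mg); last by exists K.
  have := mean0; rewrite unlock /mean /Rintegral => h.
  rewrite (_ : (\int[P]_t (g (omega 0 t))%:E)%E = 0%E)// -h.
  apply: ae_eq_integral => //.
  - by apply/measurable_EFinP; case: (bg 0).
  - exact/measurable_EFinP.
  - by apply: filterS gL => t /= -> _.
pose s2 := mean P (fun t => g (omega 0 t) ^+ 2).
have gm2 x : mean P (fun t => g (omega x t) ^+ 2) = s2.
  rewrite (mean_ident (h := fun w => g w ^+ 2) x 0 ident)//.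
    exact: measurable_funX.
  by exists (K ^+ 2) => w; rewrite normrX lerXn2r// nnegrE.
have s20 : 0 < s2.
  have bg2 : bounded_rv (fun t => g (omega 0 t) ^+ 2).
    by under eq_fun do rewrite expr2; exact: bounded_rvM.
  (* The mean of log rho is 0, so its variance is its second moment, which equals [s2] because [g]
     and [L] agree almost everywhere. *)
  rewrite -lte_fin; apply: lt_le_trans var_gt0 _.
  rewrite /variance unlock mean0 /= unlock /s2 /mean /Rintegral fineK; last first.
    exact: integrable_fin_num (bounded_rv_integrable P bg2).
  rewrite le_eqVlt; apply/orP; left; apply/eqP.
  apply: ae_eq_integral => //.
  - apply/measurable_EFinP; apply: measurable_funM;
      by apply: measurable_funB => //; exact: measurable_cst.
  - by apply/measurable_EFinP; case: bg2.
  - by apply: filterS gL => t /= -> _; rewrite !fctE /= subr0 expr2.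
have hv := valley_ae_all indep mg gK gm0 gm2 s20.
(* Countably many sites, hence a single null set for all of them. *)
have hb : {ae P, forall t, forall x, eps <= omega x t <= 1 - eps}.
  pose F k := if unpickle k is Some x then
    ~` [set t | eps <= omega x t <= 1 - eps] else set0.
  have nF k : P.-negligible (F k).
    by rewrite /F; case: unpickle => [x|]; [exact: Pband|exact: negligible_set0].
  apply: negligibleS (negligible_bigcup nF) => t /= /existsNP [x hx].
  by exists (pickle x) => //; rewrite /F pickleK.
apply: filterS2 hv hb => t ht bt.
apply: (@valleys_recurrent _ _ _ _ omega g t) => // x.
exact: gE.
Qed.
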